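(* Let $k\ge1$ be an integer, $\lambda_1,\lambda_2>0$, $0<\nu<1$ and $\eta>0$. Let $\{\mathscr{D}_{\eta,\nu}(t)\}_{t\ge0}$ be the tempered stable subordinator with stability index $\nu$ and tempering parameter $\eta$, independent of the Skellam process of order $k$, $\{S^{k}(t)\}_{t\ge0}$, with parameters $\lambda_1,\lambda_2$. Then the probability mass function $p^{f_{2}}(n,t)=\mathrm{Pr}\{S^{k}(\mathscr{D}_{\eta,\nu}(t))=n\}$, $n\in\mathbb{Z}$, is the solution of the following differential equation: $$\left(\eta^{\nu}-\frac{\mathrm{d}}{\mathrm{d} t}\right)^{1/\nu}p^{f_{2}}(n,t)=\eta\, p^{f_{2}}(n,t)+k(\lambda_{1}+\lambda_{2})p^{f_{2}}(n,t)-\lambda_{1}\sum_{j=1}^{k}p^{f_{2}}(n-j,t)-\lambda_{2}\sum_{j=1}^{k}p^{f_{2}}(n+j,t).$$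
   Context: Poisson process of order $k$ (PPoK) with intensity $\lambda>0$: $N^k(t)=\sum_{i=1}^{N(t)}X_i$, where $\{N(t)\}_{t\ge0}$ is a Poisson process with intensity $k\lambda$, and $\{X_i\}_{i\ge1}$ are iid, uniform on $\{1,2,\dots,k\}$, and independent of $\{N(t)\}_{t\ge0}$. Skellam process of order $k$ (SPoK): $S^k(t)=N_1^k(t)-N_2^k(t)$, where $\{N_1^k(t)\}_{t\ge0}$ and $\{N_2^k(t)\}_{t\ge0}$ are independent PPoK with intensities $\lambda_1>0$ and $\lambda_2>0$, respectively. Tempered stable subordinator (TSS): the subordinator $\{\mathscr{D}_{\eta,\nu}(t)\}_{t\ge0}$ with $\mathbb{E}(e^{-s\mathscr{D}_{\eta,\nu}(t)})=e^{-tf_2(s)}$, where $f_{2}(s)=(\eta+s)^{\nu}-\eta^{\nu}$, $s>0$. Operator: with $\beta=1/\nu$, if $\beta=m$ is an integer then $(\eta^\nu-\frac{\mathrm{d}}{\mathrm{d}t})^{\beta}$ is the $m$-fold composition of $\eta^\nu-\frac{\mathrm{d}}{\mathrm{d}t}$. If $m-1<\beta<m$ with $m$ an integer, then $$\left(\eta^{\nu}-\frac{\mathrm{d}}{\mathrm{d} t}\right)^{\beta}u(t)=e^{\eta^\nu t}\left(-\frac{\mathrm{d}}{\mathrm{d}t}\right)^{m}\left[\frac{1}{\Gamma(m-\beta)}\int_t^\infty (r-t)^{m-\beta-1}e^{-\eta^\nu r}u(r)\,\mathrm{d}r\right],\quad t>0,$$ so that $e^{-\theta t}$ is mapped to $(\eta^\nu+\theta)^{\beta}e^{-\theta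 t}$ for $\theta\ge0$. *)

(* Defs.v *)
From HB Require Import structures.
From mathcomp Require Import all_boot all_order all_algebra.
From mathcomp Require Import all_classical all_reals all_analysis.

Set Implicit Arguments.
Unset Strict Implicit.
Unset Printing Implicit Defensive.

Import Order.TTheory GRing.Theory Num.Theory.
Import numFieldNormedType.Exports.

Local Open Scope classical_set_scope.
Local Open Scope ring_scope.

(* int carries the discrete sigma-algebra, as nat does in the library. *)
HB.instance Definition _ := isPointed.Build int 0.
HB.instance Definition _ := @isMeasurable.Build default_measure_display
  int discrete_measurable discrete_measurable0
  discrete_measurableC discrete_measurableU.

(* Stochastic processes in continuous time are functions X : R -> T -> E of
   which only the values X t with 0 <= t matter. Path properties are required
   of every outcome, so that a process evaluated at a random time is again
   measurable. *)

Section independence.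
Context {d : measure_display} {T : measurableType d} {R : realType}.
Variable P : probability T R.

Definition generated_sigma {I : Type} {d' : measure_display}
    {E : measurableType d'} (J : set I) (X : I -> T -> E) : set (set T) :=
  <<s [set A | exists i B, [/\ J i, measurable B & A = X i @^-1` B]] >>.

Definition independent_families {I I' : Type} {d1 d2 : measure_display}
    {E1 : measurableType d1} {E2 : measurableType d2}
    (J : set I) (X : I -> T -> E1) (J' : set I') (Y : I' -> T -> E2) : Prop :=
  forall A B, generated_sigma J X A -> generated_sigma J' Y B ->
    P (A `&` B) = (P A * P B)%E.

Definition independent_processes {d1 d2 : measure_display}
    {E1 : measurableType d1} {E2 : measurableType d2}
    (X : R -> T -> E1) (Y : R -> T -> E2) : Prop :=
  independent_families [set t | 0 <= t] X [set t | 0 <= t] Y.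

Definition mutually_independent {I : eqType} {d' : measure_display}
    {E : measurableType d'} (X : I -> T -> E) : Prop :=
  forall (s : seq I) (B : I -> set E), uniq s ->
    (forall i, measurable (B i)) ->
    P (\big[setI/setT]_(i <- s) (X i @^-1` B i))
    = (\prod_(i <- s) P (X i @^-1` B i))%E.

Definition independent_increments (X : R -> T -> R) : Prop :=
  forall t : nat -> R, 0 <= t 0%N -> {homo t : i j / (i < j)%N >-> i < j} ->
    mutually_independent (fun i w => X (t i.+1) w - X (t i) w).

End independence.

Section processes.
Context {d : measure_display} {T : measurableType d} {R : realType}.
Variable P : probability T R.

Definition right_continuous_path (x : R -> R) : Prop :=
  forall t : R, 0 <= t -> x r @[r --> t^'+] --> x t.

Record poisson_process (rate : R) (N : R -> T -> nat) : Prop := {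
  poisson_measurable : forall t : R, 0 <= t -> measurable_fun setT (N t) ;
  poisson_start : forall w, N 0 w = 0%N ;
  poisson_nondecreasing : forall w (s t : R), 0 <= s -> s <= t ->
    (N s w <= N t w)%N ;
  poisson_right_continuous : forall w,
    right_continuous_path (fun t => (N t w)%:R) ;
  poisson_independent_increments :
    independent_increments P (fun t w => (N t w)%:R) ;
  poisson_increment_law : forall (s t : R) n, 0 <= s -> s < t ->
    P [set w | (N t w - N s w)%N = n]
    = (poisson_pmf (rate * (t - s)) n)%:E }.

(* X i stands for the (i+1)-st jump X_{i+1}. *)
Definition iid_uniform (k : nat) (X : nat -> T -> nat) : Prop :=
  [/\ forall i, measurable_fun setT (X i),
      mutually_independent P X
    & forall i j, (1 <= j <= k)%N -> P [set w | X i w = j] = (k%:R^-1)%:E].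

Definition poisson_process_of_order (k : nat) (lambda : R)
    (Nk : R -> T -> nat) : Prop :=
  exists (N : R -> T -> nat) (X : nat -> T -> nat),
    [/\ poisson_process (k%:R * lambda) N,
        iid_uniform k X,
        independent_families P [set t | 0 <= t] N [set: nat] X
      & forall (t : R) w, 0 <= t -> Nk t w = (\sum_(i < N t w) X i w)%N].

Definition skellam_process_of_order (k : nat) (lambda1 lambda2 : R)
    (S : R -> T -> int) : Prop :=
  exists N1 N2 : R -> T -> nat,
    [/\ poisson_process_of_order k lambda1 N1,
        poisson_process_of_order k lambda2 N2,
        independent_processes P N1 N2
      & forall (t : R) w, 0 <= t -> S t w = (N1 t w)%:Z - (N2 t w)%:Z].

Record subordinator (D : R -> T -> R) : Prop := {
  subordinator_measurable : forall t : R, 0 <= t -> measurable_fun setT (D t) ;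
  subordinator_start : forall w, D 0 w = 0 ;
  subordinator_nondecreasing : forall w (s t : R), 0 <= s -> s <= t ->
    D s w <= D t w ;
  subordinator_right_continuous : forall w,
    right_continuous_path (fun t => D t w) ;
  subordinator_independent_increments : independent_increments P D ;
  subordinator_stationary_increments : forall (s t : R) (B : set R),
    0 <= s -> s <= t -> measurable B ->
    P [set w | B (D t w - D s w)] = P [set w | B (D (t - s) w)] }.

Definition tempered_stable_subordinator (eta nu : R) (D : R -> T -> R) : Prop :=
  subordinator D /\
  forall t s : R, 0 <= t -> 0 < s ->
    ('E_P[fun w => expR (- (s * D t w))]
     = (expR (- (t * ((eta + s) `^ nu - eta `^ nu))))%:E)%E.

Definition time_changed_pmf (S : R -> T -> int) (D : R -> T -> R)
    (n : int) (t : R) : R :=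
  fine (P [set w | S (D t w) w = n]).

End processes.

Section operator.
Context {R : realType}.
Implicit Types (a beta alpha t : R) (u : R -> R).
Local Notation mu := (@lebesgue_measure R).

Definition Gamma_fun (z : R) : R :=
  \int[mu]_(x in `]0, +oo[) (x `^ (z - 1) * expR (- x)).

Definition shifted_derive a u : R -> R := fun t => a * u t - derive1 u t.

Definition opp_derive u : R -> R := fun t => - derive1 u t.

Definition weyl_integrand a alpha u t : R -> R :=
  fun r => (r - t) `^ (alpha - 1) * expR (- (a * r)) * u r.

Definition weyl_integral a alpha u : R -> R := fun t =>
  (Gamma_fun alpha)^-1 * \int[mu]_(r in `]t, +oo[) weyl_integrand a alpha u t r.

(* (a - d/dt)^beta for 0 < beta; when beta is not an integer,
   (truncn beta).+1 is the integer m such that m - 1 < beta < m. *)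
Definition frac_shifted_derive a beta u : R -> R :=
  if beta \is a Num.nat then iter (Num.truncn beta) (shifted_derive a) u
  else let m := (Num.truncn beta).+1 in fun t =>
    expR (a * t) * iter m opp_derive (weyl_integral a (m%:R - beta) u) t.

(* The derivative and the integral are total functions, so this predicate says
   that all those occurring in frac_shifted_derive exist on the half-line. *)
Definition frac_shifted_derivable a beta u : Prop :=
  if beta \is a Num.nat then
    forall i (t : R), (i < Num.truncn beta)%N -> 0 < t ->
      derivable (iter i (shifted_derive a) u) t 1
  else let m := (Num.truncn beta).+1 in
    (forall t : R, 0 < t ->
      mu.-integrable `]t, +oo[ (EFin \o weyl_integrand a (m%:R - beta) u t)) /\
    (forall i (t : R), (i < m)%N -> 0 < t ->
      derivable (iter i opp_derive (weyl_integral a (m%:R - beta) u)) t 1).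

End operator.

(* Main.v *)
From HB Require Import structures.
Require Import Defs.
From mathcomp Require Import all_boot all_order all_algebra.
From mathcomp Require Import all_classical all_reals all_analysis.
From mathcomp Require Import measurable_realfun ring lra.
Import Order.TTheory GRing.Theory Num.Theory.
Import numFieldNormedType.Exports.
Set Implicit Arguments.
Unset Strict Implicit.
Unset Printing Implicit Defensive.
Local Open Scope classical_set_scope.
Local Open Scope ring_scope.

(** Write c = k (lambda1 + lambda2), a = eta^nu and Phi(z) = (eta + c (1 - z))^nu.

    The process S^k is a compound Poisson process of rate c, so that
    Pr{S^k(x) = n} = sum_j kappa_j(n) e^(-cx) (cx)^j / j!, where kappa_j is the
    law of the sum of j jumps ([skellam_process_law]). An independent random time
    D(t) averages the Poisson weights ([prob_random_time]), and therefore
    e^(-at) p(n,t) = sum_j kappa_j(n) h_j(t) with h_j(t) =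
    e^(-at) E(e^(-c D(t)) (c D(t))^j / j!). The Laplace transform of the tempered
    stable subordinator says that sum_j z^j h_j(t) = exp (-t Phi(z)) for 0 < z < 1
    ([gf_subordinated]).

    In the convolution algebra of absolutely summable sequences, where a sequence
    is determined by its generating function ([gf_inj]), the operator becomes
    multiplication. The derivative - d/dt multiplies by Phi, that is, convolves
    with the coefficients of Phi ([is_derive_pairing]); the Weyl integral of order
    al multiplies by Phi^(-al) ([gf_weyl], which rests on [weyl_exp_integral]).
    Hence (a - d/dt)^(1/nu) multiplies by Phi^(1/nu) = eta + c - c z, which has
    only two coefficients ([frac_shifted_derive_tempered]). Multiplication by z
    delays h by one index, which replaces kappa_j by kappa_(j+1), the average of
    kappa_j over one more jump; this is the sum over neighbouring states in the
    equation ([jump_time_changed_pmf]).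

    Real generating functions avoid complex powers, but the Laplace transform
    gives them for z < 1 only, whereas p(n,t) pairs h with the merely bounded sequence
    kappa(n). This is why all estimates are made in the l1 norm: t |-> h(t) is
    differentiable in that norm because w(t + e), for any family w with generating
    functions C(z) exp (-t Phi(z)), is the exponential series in e of the bounded
    operator of convolution with the coefficients of Phi ([gf_exp_semigroup]). *)

(** * Absolutely summable sequences *)

Section summable_sequences.
Context {R : realType}.
Implicit Types (x y : nat -> R) (M : R).

(** A bound M on the l1 norm, stated on partial sums: it carries summability
    and the norm estimate in one hypothesis. *)
Definition l1_le M x := forall N, \sum_(0 <= j < N) `|x j| <= M.

Definition tsum x := limn (series x).

Lemma l1_le_ge0 M x : l1_le M x -> 0 <= M.
Proof. by move/(_ 0%N); rewrite big_nil. Qed.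

Lemma l1_le_weaken M M' x : M <= M' -> l1_le M x -> l1_le M' x.
Proof. by move=> MM' xM N; apply: le_trans (xM N) MM'. Qed.

Lemma l1_le_dom M x y : (forall j, `|x j| <= `|y j|) -> l1_le M y -> l1_le M x.
Proof. by move=> xy yM N; apply: le_trans (yM N); apply: ler_sum. Qed.

Lemma l1_le_coef M x j : l1_le M x -> `|x j| <= M.
Proof.
move=> /(_ j.+1); rewrite big_nat_recr//=; apply: le_trans.
by rewrite lerDr; apply: sumr_ge0.
Qed.

Lemma l1_leD M M' x y : l1_le M x -> l1_le M' y ->
  l1_le (M + M') (fun j => x j + y j).
Proof.
move=> xM yM N; apply: le_trans (lerD (xM N) (yM N)).
by rewrite -big_split/=; apply: ler_sum => j _; exact: ler_normD.
Qed.

Lemma l1_leZ M x (a : R) : l1_le M x -> l1_le (`|a| * M) (fun j => a * x j).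
Proof.
move=> xM N; under eq_bigr do rewrite normrM.
by rewrite -mulr_sumr ler_wpM2l.
Qed.

Lemma l1_leN M x : l1_le M x -> l1_le M (fun j => - x j).
Proof. by apply: l1_le_dom => j; rewrite normrN. Qed.

Lemma l1_le_weight M x (kap : nat -> R) : (forall j, `|kap j| <= 1) ->
  l1_le M x -> l1_le M (fun j => kap j * x j).
Proof. by move=> k1; apply: l1_le_dom => j; rewrite normrM ler_piMl. Qed.

Lemma l1_le_sum (x : nat -> nat -> R) (m : nat -> R) K :
  (forall k, l1_le (m k) (x k)) ->
  l1_le (\sum_(0 <= k < K) m k) (fun j => \sum_(0 <= k < K) x k j).
Proof.
move=> xm; elim: K => [|K IH] N.
  by rewrite big_nil big1// => j _; rewrite big_nil normr0.
under eq_bigr do rewrite big_nat_recr//=.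
by rewrite big_nat_recr//=; exact: l1_leD.
Qed.

Lemma l1_cvg_norm M x : l1_le M x -> cvgn [normed series x].
Proof.
move=> xM; apply: nondecreasing_is_cvgn.
- by apply: nondecreasing_series => n _ _; exact: normr_ge0.
- by exists M => _ [N _ <-]; exact: xM.
Qed.

Lemma l1_cvg M x : l1_le M x -> cvgn (series x).
Proof. by move=> /l1_cvg_norm; exact: normed_cvg. Qed.

Lemma tsum_norm_le M x : l1_le M x -> `|tsum x| <= M.
Proof.
move=> xM; apply: (le_trans (lim_series_norm (l1_cvg_norm xM))).
by apply: limr_le; [exact: l1_cvg_norm xM|apply: nearW => N; exact: xM].
Qed.

Lemma tsum_ge0 x : (forall j, 0 <= x j) -> 0 <= tsum x.
Proof.
move=> x0; have [xc|xc] := pselect (cvgn (series x)); last first.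
  by rewrite /tsum dvgP.
by apply: limr_ge => //; apply: nearW => n; apply: sumr_ge0.
Qed.

Lemma tsumD M M' x y : l1_le M x -> l1_le M' y ->
  tsum (fun j => x j + y j) = tsum x + tsum y.
Proof. by move=> /l1_cvg xc /l1_cvg yc; rewrite /tsum -lim_seriesD. Qed.

Lemma tsumZ M x (a : R) : l1_le M x -> tsum (fun j => a * x j) = a * tsum x.
Proof. by move=> /l1_cvg xc; rewrite /tsum -[RHS]/(a *: _) -lim_seriesZ. Qed.

Lemma tsumN M x : l1_le M x -> tsum (fun j => - x j) = - tsum x.
Proof. by move=> /l1_cvg xc; rewrite /tsum -lim_seriesN. Qed.

Lemma tsum_sum (x : nat -> nat -> R) (m : nat -> R) K :
  (forall k, l1_le (m k) (x k)) ->
  tsum (fun j => \sum_(0 <= k < K) x k j) = \sum_(0 <= k < K) tsum (x k).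
Proof.
move=> xm; elim: K => [|K IH].
  rewrite big_nil; under [in LHS]eq_fun do rewrite big_nil.
  rewrite /tsum; apply: cvg_lim => //; rewrite seriesEnat/=.
  by under eq_fun do rewrite big1//; exact: cvg_cst.
under [in LHS]eq_fun do rewrite big_nat_recr//=.
by rewrite (tsumD (l1_le_sum K xm) (xm K)) IH big_nat_recr.
Qed.

Lemma eq_tsum x y : x =1 y -> tsum x = tsum y.
Proof. by move=> /funext ->. Qed.

Lemma tsum_finite x N : (forall j, (N <= j)%N -> x j = 0) ->
  tsum x = \sum_(0 <= j < N) x j.
Proof.
move=> x0; apply: cvg_lim => //; apply: (@cvg_near_cst _ _ _ _ _ _).
near=> n; rewrite /series/= (@big_cat_nat _ _ _ N)//=; last first.
  by near: n; exists N.
rewrite [X in _ + X]big_nat_cond [X in _ + X]big1 ?addr0// => j.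
by rewrite andbT => /andP[Nj _]; exact: x0.
Unshelve. all: by end_near. Qed.

Lemma tsum_recl M x : l1_le M x -> tsum x = x 0%N + tsum (fun j => x j.+1).
Proof.
move=> xM; have xc := l1_cvg xM.
have H : series (fun j => x j.+1) = (fun n => series x n.+1 - x 0%N).
  apply/funext => n; rewrite /series/= big_nat_recl//= addrC addKr.
  by [].
rewrite /tsum H; apply/eqP; rewrite addrC -subr_eq; apply/eqP/esym.
apply: cvg_lim => //; apply: cvgB; last exact: cvg_cst.
by rewrite (cvg_shiftS (series x)).
Qed.

Lemma sum_nat_addr (f : nat -> R) K N :
  \sum_(0 <= k < N) f (k + K)%N = \sum_(0 <= k < K + N) f k - \sum_(0 <= k < K) f k.
Proof.
rewrite [in RHS](@big_cat_nat _ _ _ K)//= ?leq_addr// [X in X - _]addrC addrK.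
by rewrite -{2}[K]add0n big_addn addKn.
Qed.

Lemma l1_le_tail M x K : l1_le M x ->
  l1_le (M - \sum_(0 <= k < K) `|x k|) (fun k => x (k + K)%N).
Proof. by move=> xM N; rewrite (sum_nat_addr (fun k => `|x k|)) lerB. Qed.

Lemma tsum_tail M x K : l1_le M x ->
  tsum (fun k => x (k + K)%N) = tsum x - \sum_(0 <= k < K) x k.
Proof.
move=> xM; apply: cvg_lim => //.
have -> : series (fun k => x (k + K)%N) =
    (fun n => series x (n + K)%N - \sum_(0 <= k < K) x k).
  by apply/funext => n; rewrite /series/= sum_nat_addr addnC.
apply: cvgB; last exact: cvg_cst.
by rewrite cvg_shiftn; exact: l1_cvg xM.
Qed.

Lemma l1_le_double (x : nat -> nat -> R) (m : nat -> R) M :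
  (forall k, l1_le (m k) (x k)) -> l1_le M m ->
  l1_le (tsum m) (fun j => tsum (x ^~ j)).
Proof.
move=> xm mM N.
have m0 k : 0 <= m k := l1_le_ge0 (xm k).
have cx j : l1_le M (x ^~ j).
  apply: l1_le_dom mM => k; rewrite (ger0_norm (m0 k)).
  exact: l1_le_coef (xm k).
have cxn j : l1_le M (fun k => `|x k j|).
  by apply: l1_le_dom (cx j) => k; rewrite normr_id.
apply: (@le_trans _ _ (\sum_(0 <= j < N) tsum (fun k => `|x k j|))).
  apply: ler_sum => j _; apply: lim_series_norm.
  exact: l1_cvg_norm (cx j).
rewrite -(@tsum_sum (fun j k => `|x k j|) (fun=> M) N)//.
apply: lim_series_le; [|exact: l1_cvg mM|by move=> k; exact: xm].
have := l1_le_sum N cxn.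
exact: l1_cvg.
Qed.

(** After removing the first K rows, the two iterated sums of the remaining rows
    are bounded by the tail of the series m of row bounds. *)
Lemma tsum_exchange (x : nat -> nat -> R) (m : nat -> R) M :
  (forall k, l1_le (m k) (x k)) -> l1_le M m ->
  tsum (fun j => tsum (x ^~ j)) = tsum (fun k => tsum (x k)).
Proof.
move=> xm mM; have m0 k : 0 <= m k := l1_le_ge0 (xm k).
have cx j : l1_le M (x ^~ j).
  apply: l1_le_dom mM => k; rewrite (ger0_norm (m0 k)).
  exact: l1_le_coef (xm k).
have bound K : `|tsum (fun j => tsum (x ^~ j)) - \sum_(0 <= k < K) tsum (x k)|
    <= tsum m - \sum_(0 <= k < K) m k.
  rewrite -(tsum_sum K xm) -(tsum_tail K mM).
  have l1s := l1_le_double xm mM.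
  rewrite -(tsumN (l1_le_sum K xm)).
  rewrite -(tsumD l1s (l1_leN (l1_le_sum K xm))).
  have -> : (fun j => tsum (x ^~ j) - \sum_(0 <= k < K) x k j) =
            (fun j => tsum ((fun k => x (k + K)%N) ^~ j)).
    by apply/funext => j; rewrite -(tsum_tail K (cx j)).
  apply: tsum_norm_le; apply: (l1_le_double (M := M - \sum_(0 <= k < K) m k)).
  - by move=> k; exact: xm.
  - move=> N; have := l1_le_tail K mM N.
    suff -> : \sum_(0 <= k < K) `|m k| = \sum_(0 <= k < K) m k by [].
    by apply: eq_bigr => k _; exact: ger0_norm.
apply/esym/cvg_lim => //; apply/cvgrPdist_le => /= e e0.
have /cvgrPdist_le/(_ _ e0) := l1_cvg mM.
apply: filterS => K mK; apply: (le_trans (bound K)).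
by apply: le_trans mK; rewrite ler_norm.
Qed.

End summable_sequences.

(** * Generating functions and convolution *)

Section generating_functions.
Context {R : realType}.
Implicit Types (x y a b : nat -> R) (M A B z : R).

Definition delay x j : R := if j is j'.+1 then x j' else 0.

Definition conv a b n : R := \sum_(0 <= i < n.+1) a i * b (n - i)%N.

Definition gf z x : R := tsum (fun j => z ^+ j * x j).

Lemma l1_le_delay M x : l1_le M x -> l1_le M (delay x).
Proof.
move=> xM [|N]; first by rewrite big_nil; exact: l1_le_ge0 xM.
by rewrite big_nat_recl//= normr0 add0r; exact: xM.
Qed.

Lemma tsum_delay M x : l1_le M x -> tsum (delay x) = tsum x.
Proof. by move=> /l1_le_delay xM; rewrite (tsum_recl xM)/= add0r. Qed.

Lemma iter_delayE k x j :
  iter k delay x j = if (k <= j)%N then x (j - k)%N else 0.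
Proof.
elim: k j => [|k IH] j /=; first by rewrite subn0.
by case: j => [|j] //=; rewrite IH ltnS subSS.
Qed.

Lemma l1_le_iter_delay k M x : l1_le M x -> l1_le M (iter k delay x).
Proof. by elim: k => //= k IH xM; exact: l1_le_delay (IH xM). Qed.

Lemma tsum_iter_delay k M x : l1_le M x -> tsum (iter k delay x) = tsum x.
Proof.
move=> xM; elim: k => //= k IH.
by rewrite (tsum_delay (l1_le_iter_delay k xM)).
Qed.

Let cauchy_terms a b k j := a k * iter k delay b j.

Let tsum_cauchy_terms a b j : tsum (cauchy_terms a b ^~ j) = conv a b j.
Proof.
rewrite (@tsum_finite _ _ j.+1)/cauchy_terms; last first.
  by move=> k jk; rewrite iter_delayE leqNgt jk/= mulr0.
rewrite /conv big_nat_cond [RHS]big_nat_cond; apply: eq_bigr => k.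
by rewrite andbT ltnS iter_delayE => /andP[_ ->].
Qed.

Let l1_le_mulr A a B : 0 <= B -> l1_le A a ->
  l1_le (A * B) (fun k => `|a k| * B).
Proof.
move=> B0 aA N; under eq_bigr do rewrite normrM normr_id (ger0_norm B0).
by rewrite -mulr_suml ler_wpM2r.
Qed.

Lemma l1_le_conv A B a b : l1_le A a -> l1_le B b ->
  l1_le (A * B) (conv a b).
Proof.
move=> aA bB; have B0 := l1_le_ge0 bB.
have xm k : l1_le (`|a k| * B) (cauchy_terms a b k).
  by apply: l1_leZ; exact: l1_le_iter_delay.
have mM := l1_le_mulr B0 aA.
have := l1_le_double xm mM.
have -> : (fun j => tsum (cauchy_terms a b ^~ j)) = conv a b.
  by apply/funext => j; exact: tsum_cauchy_terms.
by apply: l1_le_weaken; apply: le_trans (tsum_norm_le mM); rewrite ler_norm.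
Qed.

(** The rows of the Cauchy double series are the delayed copies of b, weighted
    by the entries of a; its column sums are the entries of the convolution. *)
Lemma tsum_conv A B a b : l1_le A a -> l1_le B b ->
  tsum (conv a b) = tsum a * tsum b.
Proof.
move=> aA bB; have B0 := l1_le_ge0 bB.
have xm k : l1_le (`|a k| * B) (cauchy_terms a b k).
  by apply: l1_leZ; exact: l1_le_iter_delay.
rewrite -(eq_tsum (tsum_cauchy_terms a b)).
rewrite (tsum_exchange xm (l1_le_mulr B0 aA)).
rewrite mulrC -(tsumZ _ aA); apply: eq_tsum => k.
by rewrite (tsumZ _ (l1_le_iter_delay k bB)) (tsum_iter_delay _ bB) mulrC.
Qed.

Lemma norm_expr_le1 z j : 0 < z < 1 -> `|z ^+ j| <= 1.
Proof.
by move=> /andP[z0 z1]; rewrite ger0_norm ?exprn_ge0 ?exprn_ile1// ltW.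
Qed.

Lemma l1_le_gf z M x : 0 < z < 1 -> l1_le M x ->
  l1_le M (fun j => z ^+ j * x j).
Proof. by move=> z01; apply: l1_le_weight => j; exact: norm_expr_le1. Qed.

Lemma gf_conv z A B a b : 0 < z < 1 -> l1_le A a -> l1_le B b ->
  gf z (conv a b) = gf z a * gf z b.
Proof.
move=> z01 aA bB; rewrite -(tsum_conv (l1_le_gf z01 aA) (l1_le_gf z01 bB)).
apply: eq_tsum => n; rewrite /conv mulr_sumr; apply: eq_big_nat => i.
rewrite ltnS => /andP[_ ni].
by rewrite mulrACA -exprD subnKC.
Qed.

Lemma gf_delay z M x : 0 < z < 1 -> l1_le M x -> gf z (delay x) = z * gf z x.
Proof.
move=> z01 xM; rewrite -(tsumZ _ (l1_le_gf z01 xM)).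
rewrite /gf (tsum_recl (l1_le_gf z01 (l1_le_delay xM)))/= mulr0 add0r.
by apply: eq_tsum => j; rewrite exprS mulrA.
Qed.

Lemma l1_le_succ M x : l1_le M x -> l1_le M (fun j => x j.+1).
Proof.
by move=> xM N; apply: le_trans (xM N.+1); rewrite big_nat_recl//= lerDr.
Qed.

Lemma gf_recl z M x : 0 < z < 1 -> l1_le M x ->
  gf z x = x 0%N + z * gf z (fun j => x j.+1).
Proof.
move=> z01 xM; rewrite /gf (tsum_recl (l1_le_gf z01 xM)) expr0 mul1r.
congr (_ + _).
rewrite -(tsumZ _ (l1_le_gf z01 (l1_le_succ xM))).
by apply: eq_tsum => j; rewrite exprS mulrA.
Qed.

(** If x 0 were not 0, the remainder z * gf z (x shifted) could not cancel it
    for z small; then one divides by z and repeats. *)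
Lemma gf_eq0 M x : l1_le M x -> (forall z, 0 < z < 1 -> gf z x = 0) ->
  forall j, x j = 0.
Proof.
have constant_coef y : l1_le M y -> (forall z, 0 < z < 1 -> gf z y = 0) ->
    y 0%N = 0.
  move=> yM y0; apply/eqP; rewrite -normr_le0 leNgt; apply/negP => y00.
  have M0 := l1_le_ge0 yM.
  (* z is chosen so that z * M < |y 0|, and z < 1 *)
  pose z := `|y 0%N| / (2 * `|y 0%N| + M).
  have d0 : 0 < 2 * `|y 0%N| + M by lra.
  have z01 : 0 < z < 1 by rewrite divr_gt0//= ltr_pdivrMr//; lra.
  have := y0 _ z01; rewrite (gf_recl z01 yM) => /eqP; rewrite addr_eq0.
  move=> /eqP/(congr1 Num.norm); rewrite normrN normrM.
  have := tsum_norm_le (l1_le_gf z01 (l1_le_succ yM)); rewrite -/(gf _ _).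
  case/andP: z01 => z0 _; rewrite (gtr0_norm z0) => gM yE.
  have : `|y 0%N| <= z * M by rewrite yE ler_wpM2l// ltW.
  by rewrite /z mulrAC ler_pdivlMr// ler_pM2l//; lra.
move=> + + j; elim: j x => [|j IH] x xM x0; first exact: constant_coef.
apply: (IH (fun j => x j.+1) (l1_le_succ xM)) => z z01.
have := x0 _ z01.
rewrite (gf_recl z01 xM) (constant_coef _ xM x0) add0r => /eqP.
by rewrite mulf_eq0 gt_eqF//=; [move/eqP|case/andP: z01].
Qed.

Lemma gf_inj M M' x y : l1_le M x -> l1_le M' y ->
  (forall z, 0 < z < 1 -> gf z x = gf z y) -> x = y.
Proof.
move=> xM yM xy; apply/funext => j; apply/eqP; rewrite -subr_eq0; apply/eqP.
apply: (gf_eq0 (l1_leD xM (l1_leN yM))) => z z01.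
have yzM := l1_le_gf z01 yM.
rewrite /gf; under eq_tsum do rewrite mulrDr mulrN.
rewrite (tsumD (l1_le_gf z01 xM) (l1_leN yzM)) (tsumN yzM).
by rewrite -/(gf z x) -/(gf z y) xy// subrr.
Qed.

End generating_functions.

(** * Semigroups of summable sequences and their time derivatives *)

Section semigroup.
Context {R : realType}.
Implicit Types (x b c kap : nat -> R) (M B z t e : R).

Lemma l1_le_exp_coeff M (x : R) : `|x| <= M -> l1_le (expR M) (exp_coeff x).
Proof.
move=> xM N; have M0 : 0 <= M := le_trans (normr_ge0 x) xM.
apply: (@le_trans _ _ (series (exp_coeff M) N)).
  apply: ler_sum => k _; rewrite /exp_coeff/= normrM normfV normrX.
  by rewrite (ger0_norm (ler0n _ _)) ler_wpM2r ?invr_ge0// lerXn2r ?nnegrE.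
apply: nondecreasing_cvgn_le (is_cvg_series_exp_coeff M) N.
by apply: nondecreasing_series => n _ _; exact: exp_coeff_ge0.
Qed.

Lemma l1_le_iter_conv k B M b x : l1_le B b -> l1_le M x ->
  l1_le (B ^+ k * M) (iter k (conv b) x).
Proof.
move=> bB xM; elim: k => [|k IH] /=; first by rewrite expr0 mul1r.
by rewrite exprS -mulrA; exact: l1_le_conv.
Qed.

Lemma gf_iter_conv z k B M b x : 0 < z < 1 -> l1_le B b -> l1_le M x ->
  gf z (iter k (conv b) x) = gf z b ^+ k * gf z x.
Proof.
move=> z01 bB xM; elim: k => [|k IH] /=; first by rewrite expr0 mul1r.
by rewrite (gf_conv z01 bB (l1_le_iter_conv k bB xM)) IH exprS mulrA.
Qed.

Lemma is_derive_quadratic (F : R -> R) (t l d C : R) : 0 < d ->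
  (forall e, `|e| < d -> `|F (t + e) - F t - e * l| <= C * e ^+ 2) ->
  is_derive t 1 F l.
Proof.
move=> d0 Fq.
have lim0 : (fun h => h^-1 * (F (t + h) - F t) - l) x @[x --> 0^'] --> 0.
  apply: (@cvg_to_0_linear _ _ C d) => // h /andP[h0 hd].
  have h00 : h != 0 by rewrite -normr_gt0.
  have -> : h^-1 * (F (t + h) - F t) - l = h^-1 * (F (t + h) - F t - h * l).
    by field.
  rewrite normrM normfV mulrC ler_pdivrMr// -mulrA -expr2 real_normK ?num_real//.
  exact: Fq.
have lim : h^-1 *: (F (h *: 1 + t) - F t) @[h --> 0^'] --> l.
  have -> : (fun h => h^-1 *: (F (h *: 1 + t) - F t)) =
      (fun h => (h^-1 * (F (t + h) - F t) - l) + l).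
    by apply/funext => h; rewrite subrK [h *: 1]mulr1 [h + t]addrC.
  by rewrite -[X in _ --> X]add0r; apply: cvgD; [exact: lim0|exact: cvg_cst].
apply: DeriveDef; last exact: cvg_lim lim.
by apply/cvg_ex; exists l.
Qed.

Lemma l1_le_exp_bounds M B e : 0 <= B -> 0 <= M ->
  l1_le (M * expR (`|e| * B)) (fun k => `|exp_coeff (- e) k| * (B ^+ k * M)).
Proof.
move=> B0 M0; rewrite -{1}(ger0_norm M0).
apply: (@l1_le_dom _ _ _ (fun k => M * exp_coeff (`|e| * B) k)); last first.
  by apply: l1_leZ; apply: l1_le_exp_coeff; rewrite ger0_norm ?mulr_ge0.
move=> k; rewrite le_eqVlt; apply/orP; left; apply/eqP; congr (`|_|).
rewrite /exp_coeff/= normrM normfV normrX normrN (ger0_norm (ler0n _ _)).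
by rewrite exprMn; ring.
Qed.

Lemma exp_coeff_add2 (x : R) k : 0 <= x ->
  exp_coeff x (k + 2)%N <= x ^+ 2 * exp_coeff x k.
Proof.
move=> x0; rewrite /exp_coeff/= exprD mulrAC mulrC ler_wpM2l ?sqr_ge0//.
rewrite ler_wpM2l ?exprn_ge0// lef_pV2 ?posrE ?ltr0n ?fact_gt0// ler_nat.
by rewrite addn2 !factS mulnA leq_pmull.
Qed.

(** From the third term on, the series is dominated by e^2 times an exponential
    series. *)
Lemma exp_series_quadratic (c : nat -> R) M B e : 0 <= B -> 0 <= M ->
  (forall k, `|c k| <= B ^+ k * M) -> `|e| <= 1 ->
  `|tsum (fun k => exp_coeff (- e) k * c k) - c 0%N - e * - c 1%N|
    <= M * B ^+ 2 * expR B * e ^+ 2.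
Proof.
move=> B0 M0 cM e1.
have eB0 : 0 <= `|e| * B by rewrite mulr_ge0.
have eB : `| `|e| * B | <= B by rewrite ger0_norm// ler_piMl.
have coef_le k : `|exp_coeff (- e) k * c k| <= M * exp_coeff (`|e| * B) k.
  rewrite normrM /exp_coeff/= normrM normfV normrX normrN (ger0_norm (ler0n _ _)).
  rewrite exprMn [leRHS]mulrC -!mulrA ler_wpM2l ?exprn_ge0//.
  by rewrite [leRHS]mulrCA ler_wpM2l ?invr_ge0// mulrC [leRHS]mulrC.
have l1c : l1_le (M * expR B) (fun k => exp_coeff (- e) k * c k).
  apply: (@l1_le_dom _ _ _ (fun k => M * exp_coeff (`|e| * B) k)).
    by move=> k; apply: le_trans (coef_le k) _; rewrite ler_norm.
  by have := l1_leZ M (l1_le_exp_coeff eB); rewrite (ger0_norm M0).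
have := tsum_tail 2 l1c; rewrite !big_nat_recr//= big_nil add0r.
have -> : exp_coeff (- e) 0%N = 1 by rewrite /exp_coeff/= expr0 divr1.
have -> : exp_coeff (- e) 1%N = - e by rewrite /exp_coeff/= expr1 divr1.
rewrite mul1r opprD addrA mulrN mulNr => <-.
have K0 : 0 <= M * (`|e| * B) ^+ 2 by rewrite mulr_ge0 ?sqr_ge0.
have -> : M * B ^+ 2 * expR B * e ^+ 2 = `|M * (`|e| * B) ^+ 2| * expR B.
  by rewrite (ger0_norm K0) exprMn real_normK ?num_real//; ring.
apply: tsum_norm_le.
apply: (@l1_le_dom _ _ _ (fun k => M * (`|e| * B) ^+ 2 * exp_coeff (`|e| * B) k)).
  move=> k; apply: le_trans (coef_le _) _.
  apply: le_trans _ (ler_norm _); rewrite -mulrA ler_wpM2l//.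
  exact: exp_coeff_add2.
by apply: l1_leZ; exact: l1_le_exp_coeff.
Qed.

(** Both sides have generating function C(z) exp (-(t + e) Phi(z)): convolution
    with b multiplies by Phi, so the right-hand side expands exp (-e Phi) in
    powers of Phi. The expansion holds for e of either sign. *)
Lemma gf_exp_semigroup (w : R -> nat -> R) (Mw : R -> R) (C Phi : R -> R) B b t e :
  l1_le B b -> (forall z, 0 < z < 1 -> gf z b = Phi z) ->
  (forall t, 0 < t -> l1_le (Mw t) (w t)) ->
  (forall t z, 0 < t -> 0 < z < 1 ->
    gf z (w t) = C z * expR (- (t * Phi z))) ->
  0 < t -> 0 < t + e ->
  w (t + e) = fun j =>
    tsum (fun k => exp_coeff (- e) k * iter k (conv b) (w t) j).
Proof.
move=> bB bPhi wM wC t0 te0.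
have B0 := l1_le_ge0 bB; have M0 := l1_le_ge0 (wM _ t0).
have xm k : l1_le (`|exp_coeff (- e) k| * (B ^+ k * Mw t))
    (fun j => exp_coeff (- e) k * iter k (conv b) (w t) j).
  by apply: l1_leZ; apply: l1_le_iter_conv => //; exact: wM.
have mM : l1_le (Mw t * expR (`|e| * B))
    (fun k => `|exp_coeff (- e) k| * (B ^+ k * Mw t)).
  exact: l1_le_exp_bounds.
have vM := l1_le_double xm mM.
apply: (gf_inj (wM _ te0) vM) => z z01.
rewrite wC// /gf.
have -> : tsum (fun j => z ^+ j * tsum (fun k =>
      exp_coeff (- e) k * iter k (conv b) (w t) j)) =
    tsum (fun j => tsum (fun k =>
      z ^+ j * (exp_coeff (- e) k * iter k (conv b) (w t) j))).
  apply: eq_tsum => j; rewrite (@tsumZ _ (Mw t * expR (`|e| * B)))//.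
  apply: l1_le_dom mM => k; rewrite [leRHS]ger0_norm ?(l1_le_ge0 (xm k))//.
  exact: l1_le_coef (xm k).
rewrite (tsum_exchange (fun k => l1_le_gf z01 (xm k)) mM).
rewrite mulrDl opprD expRD mulrA -(wC t z)// -mulNr.
rewrite -[expR (- e * _)]/(tsum (exp_coeff (- e * Phi z))).
rewrite -(tsumZ _ (l1_le_exp_coeff (lexx _))).
apply: eq_tsum => k.
have H := l1_le_iter_conv k bB (wM _ t0).
transitivity (exp_coeff (- e) k * gf z (iter k (conv b) (w t))).
  rewrite (gf_iter_conv _ z01 bB (wM _ t0)) bPhi// /exp_coeff/= exprMn; ring.
rewrite -(tsumZ _ (l1_le_gf z01 H)).
by apply: eq_tsum => j; rewrite mulrCA.
Qed.

(** The bounded functional kap commutes with the expansion of w (t + e) in powers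
    of e, which leaves a scalar exponential series with first-order coefficient
    given by one convolution with b. *)
Lemma is_derive_pairing (w : R -> nat -> R) (Mw : R -> R) (C Phi : R -> R)
    B b kap t :
  l1_le B b -> (forall z, 0 < z < 1 -> gf z b = Phi z) ->
  (forall t, 0 < t -> l1_le (Mw t) (w t)) ->
  (forall t z, 0 < t -> 0 < z < 1 ->
    gf z (w t) = C z * expR (- (t * Phi z))) ->
  (forall j, `|kap j| <= 1) -> 0 < t ->
  is_derive t 1 (fun r => tsum (fun j => kap j * w r j))
    (- tsum (fun j => kap j * conv b (w t) j)).
Proof.
move=> bB bPhi wM wC kap1 t0.
have B0 := l1_le_ge0 bB; have M0 := l1_le_ge0 (wM _ t0).
pose c k := tsum (fun j => kap j * iter k (conv b) (w t) j).
have cM k : `|c k| <= B ^+ k * Mw t.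
  apply: tsum_norm_le; apply: l1_le_weight => //.
  by apply: l1_le_iter_conv => //; exact: wM.
have m0 : 0 < Num.min 1 t by rewrite lt_min ltr01.
apply: (is_derive_quadratic (C := Mw t * B ^+ 2 * expR B) m0) => e.
rewrite lt_min => /andP[e1 et].
have te0 : 0 < t + e by move: et; rewrite ltr_norml; lra.
suff -> : tsum (fun j => kap j * w (t + e) j) =
    tsum (fun k => exp_coeff (- e) k * c k).
  by apply: exp_series_quadratic => //; exact: ltW.
rewrite (gf_exp_semigroup bB bPhi wM wC t0 te0).
have xm k : l1_le (`|exp_coeff (- e) k| * (B ^+ k * Mw t))
    (fun j => exp_coeff (- e) k * (kap j * iter k (conv b) (w t) j)).
  apply: l1_leZ; apply: l1_le_weight => //.
  by apply: l1_le_iter_conv => //; exact: wM.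
have ym k : l1_le (`|exp_coeff (- e) k| * (B ^+ k * Mw t))
    (fun j => exp_coeff (- e) k * iter k (conv b) (w t) j).
  by apply: l1_leZ; apply: l1_le_iter_conv => //; exact: wM.
have mM : l1_le (Mw t * expR (`|e| * B))
    (fun k => `|exp_coeff (- e) k| * (B ^+ k * Mw t)).
  exact: l1_le_exp_bounds.
transitivity (tsum (fun k => tsum (fun j =>
    exp_coeff (- e) k * (kap j * iter k (conv b) (w t) j)))).
  rewrite -(tsum_exchange xm mM); apply: eq_tsum => j.
  rewrite -(@tsumZ _ (Mw t * expR (`|e| * B))).
    by apply: eq_tsum => k; rewrite mulrCA.
  apply: l1_le_dom mM => k; rewrite [leRHS]ger0_norm ?(l1_le_ge0 (ym k))//.
  exact: l1_le_coef (ym k).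
apply: eq_tsum => k; rewrite (@tsumZ _ (B ^+ k * Mw t))//.
by apply: l1_le_weight => //; apply: l1_le_iter_conv => //; exact: wM.
Qed.

End semigroup.

(** * The Gamma integral *)

Section gamma.
Context {R : realType}.
Implicit Types (al phi t nu : R).
Local Notation mu := (@lebesgue_measure R).
Local Open Scope ereal_scope.

(** Both sides are measures in A that agree on half-open intervals. *)
Lemma lebesgue_measure_affine phi t (A : set R) : (0 < phi)%R -> measurable A ->
  mu A = phi%:E * mu ((fun r => phi * (r - t))%R @^-1` A).
Proof.
move=> phi0 mA.
have mF : measurable_fun setT (fun r : measurableTypeR R =>
    phi * (r - t) : measurableTypeR R)%R.
  by apply: measurable_funM => //; exact: measurable_funB.
pose Fm := isMeasurableFun.Build _ _ _ _ _ mF.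
pose F : {mfun measurableTypeR R >-> measurableTypeR R} :=
  HB.pack (fun r : measurableTypeR R => phi * (r - t) : measurableTypeR R)%R Fm.
have phi0' := ltW phi0.
pose k : {nonneg R} := NngNum phi0'.
have -> : phi%:E * mu (F @^-1` A) = mscale k (pushforward mu F) A by [].
apply: lebesgue_measure_unique => // _ [[a b]] _ <-.
rewrite /mscale/= /pushforward /=.
rewrite [X in _ = _ * mu X]
    (_ : _ = `](a / phi + t)%R, (b / phi + t)%R]%classic); last first.
  apply/seteqP; split => r /=; rewrite !in_itv/= /F/=.
    move=> /andP[ar rb]; rewrite -ltrBrDr ltr_pdivrMr// mulrC ar/=.
    by rewrite -lerBlDr ler_pdivlMr// mulrC.
  rewrite -ltrBrDr ltr_pdivrMr// mulrC => /andP[->]/=.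
  by rewrite -lerBlDr ler_pdivlMr// mulrC.
rewrite !lebesgue_measure_itv/= !lte_fin ltrD2r ltr_pM2r ?invr_gt0//.
case: ifPn => _; last by rewrite mule0.
rewrite -!EFinD -EFinM; congr EFin.
by field; rewrite gt_eqF.
Qed.

(** The substitution goes through the image measure, since the functions g of
    interest are singular at 0. *)
Lemma ge0_integral_affine phi t (g : R -> \bar R) : (0 < phi)%R ->
  measurable_fun setT g -> (forall x, 0 <= g x) ->
  \int[mu]_(x in `]0%R, +oo[) g x =
  phi%:E * \int[mu]_(r in `]t, +oo[) g (phi * (r - t))%R.
Proof.
move=> phi0 mg g0.
have mF : measurable_fun setT (fun r : measurableTypeR R =>
    phi * (r - t) : measurableTypeR R)%R.
  by apply: measurable_funM => //; exact: measurable_funB.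
pose Fm := isMeasurableFun.Build _ _ _ _ _ mF.
pose F : {mfun measurableTypeR R >-> measurableTypeR R} :=
  HB.pack (fun r : measurableTypeR R => phi * (r - t) : measurableTypeR R)%R Fm.
have phi0' := ltW phi0.
pose k : {nonneg R} := NngNum phi0'.
pose D : set (measurableTypeR R) := `]0%R, +oo[%classic.
have -> : `]t, +oo[%classic = F @^-1` D.
  apply/seteqP; split => r /=; rewrite /D/= !in_itv/= !andbT /F/=.
    by move=> tr; rewrite mulr_gt0// subr_gt0.
  by rewrite pmulr_rgt0// subr_gt0.
rewrite -[X in phi%:E * X]/(\int[mu]_(r in F @^-1` D) (g \o F) r).
have mD : measurable D by exact: measurable_itv.
have mg' : measurable_fun D g by exact: measurable_funTS.
rewrite -(ge0_integral_pushforward mF)//.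
rewrite -[phi%:E]/(k%:num%:E) -ge0_integral_mscale//.
apply: eq_measure_integral => A mA _; exact: lebesgue_measure_affine.
Qed.

Definition gamma_density al (x : R) : R := (x `^ (al - 1) * expR (- x))%R.

Lemma gamma_density_ge0 al x : (0 <= gamma_density al x)%R.
Proof. by rewrite mulr_ge0 ?powR_ge0 ?expR_ge0. Qed.

Lemma measurable_gamma_density al (D : set R) :
  measurable_fun D (EFin \o gamma_density al).
Proof.
apply/measurable_EFinP; apply: measurable_funTS.
apply: measurable_funM; first exact: measurable_powR.
by apply: measurableT_comp => //; exact: measurableT_comp.
Qed.

Lemma integral_powR_le al n : (0 < al)%R ->
  \int[mu]_(x in `[(n.+1%:R^-1)%R, 1%R]) (x `^ (al - 1))%:E <= (al^-1)%:E.
Proof.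
move=> al0; have n0 : (0 < n.+1%:R^-1 :> R)%R by rewrite invr_gt0.
have [n1|n1] := ltP (n.+1%:R^-1 : R)%R 1%R; last first.
  have -> : (n.+1%:R^-1 = 1 :> R)%R.
    by apply/eqP; rewrite eq_le n1 andbT invf_le1// ler1n.
  by rewrite set_itv1 integral_set1 lee_fin invr_ge0 ltW.
have dF (x : R) : (0 < x)%R ->
    is_derive x 1%R (fun x => al^-1 * x `^ al)%R (x `^ (al - 1))%R.
  move=> x0.
  have -> : (x `^ (al - 1) = al^-1 *: (al * x `^ (al - 1)))%R.
    by rewrite /GRing.scale/= mulKf// gt_eqF.
  by apply: is_deriveZ; exact: is_derive1_powR.
have cF (x : R) : (0 < x)%R ->
    ((al^-1 * y `^ al) @[y --> x] --> al^-1 * x `^ al)%R.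
  move=> /dF [/derivable1_diffP/differentiable_continuous + _]; exact.
rewrite (@continuous_FTC2 _ _ (fun x => al^-1 * x `^ al)%R)//.
- rewrite powR1 mulr1 -EFinB lee_fin lerBlDr lerDl mulr_ge0 ?powR_ge0//.
  by rewrite invr_ge0 ltW.
- apply: derivable_within_continuous => x; rewrite in_itv/= => /andP[nx _].
  by apply: derivable_powR; rewrite in_itv/= andbT (lt_le_trans n0 nx).
- split.
  + move=> x; rewrite in_itv/= => /andP[nx _].
    by apply: ex_derive; apply: dF; exact: lt_trans nx.
  + by apply: cvg_at_right_filter; exact: cF.
  + by apply: cvg_at_left_filter; exact: cF.
- move=> x; rewrite in_itv/= => /andP[nx _]; rewrite derive1E.
  by have [_ ->] := dF x (lt_trans n0 nx).
Qed.

Lemma integral_powR_oc al : (0 < al)%R ->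
  \int[mu]_(x in `]0%R, 1%R]) (x `^ (al - 1))%:E <= (al^-1)%:E.
Proof.
move=> al0.
pose F n : set R := `[(n.+1%:R^-1)%R, 1%R]%classic.
have -> : `]0%R, 1%R]%classic = \bigcup_n F n.
  apply/seteqP; split => [x /=|x [n _]]; rewrite /= in_itv/=.
    move=> /andP[x0 x1]; exists (Num.truncn x^-1) => //; rewrite /F/= in_itv/= x1 andbT.
    rewrite invf_ple ?posrE//; apply/ltW/truncnS_gt.
  by rewrite /F/= in_itv/= => /andP[nx ->]; rewrite (lt_le_trans _ nx)// invr_gt0.
have mf i : measurable_fun (F i) (fun x : R => (x `^ (al - 1))%:E).
  by apply/measurable_EFinP; apply: measurable_funTS; exact: measurable_powR.
have ndF : nondecreasing_seq F.
  move=> m n mn; apply/subsetPset => x; rewrite /F/= !in_itv/= => /andP[nx ->].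
  rewrite andbT; apply: le_trans nx.
  by rewrite lef_pV2 ?posrE// ler_nat.
have cvgF := @ge0_nondecreasing_set_cvg_integral _ (measurableTypeR R) R F
  (fun x => (x `^ (al - 1))%:E) mu ndF (fun=> measurable_itv _) mf
  (fun i x _ => ltac:(by rewrite lee_fin powR_ge0)).
rewrite -(cvg_lim _ cvgF)//.
apply: lime_le; first by apply/cvg_ex; eexists; exact: cvgF.
by apply: nearW => n; exact: integral_powR_le.
Qed.

(** Near 0 the density is below x^(al-1), which has the primitive x^al / al, and
    beyond 1 it is below exp (-x). *)
Lemma gamma_density_integral_lty al : (0 < al < 1)%R ->
  \int[mu]_(x in `]0%R, +oo[) (gamma_density al x)%:E < +oo.
Proof.
move=> /andP[al0 al1].
have -> : `]0%R, +oo[%classic = `]0%R, 1%R]%classic `|` `]1%R, +oo[%classic :> set R.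
  by rewrite -itv_bndbnd_setU// bnd_simp.
rewrite ge0_integral_setU//=; last 3 first.
- exact: measurable_gamma_density.
- by move=> x _; rewrite lee_fin gamma_density_ge0.
- rewrite disj_set2E; apply/eqP; rewrite -subset0 => x [] /=.
  by rewrite !in_itv/= andbT => /andP[_ x1]; rewrite ltNge x1.
apply: lte_add_pinfty.
- apply: (@le_lt_trans _ _ (al^-1)%:E); last exact: ltry.
  apply: le_trans (integral_powR_oc al0).
  apply: ge0_le_integral => //=.
  + by move=> x _; rewrite lee_fin gamma_density_ge0.
  + exact: measurable_gamma_density.
  + by apply/measurable_EFinP; apply: measurable_funTS; exact: measurable_powR.
  + move=> x; rewrite in_itv/= => /andP[x0 _].
    by rewrite lee_fin ler_piMr ?powR_ge0// -expR0 ler_expR oppr_le0 ltW.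
- apply: (@le_lt_trans _ _ 1); last exact: ltry.
  rewrite -(@integral_exponential_pdf R 1%R)//.
  apply: (@le_trans _ _ (\int[mu]_(x in `]1%R, +oo[) (exponential_pdf 1 x)%:E)).
    apply: ge0_le_integral => //=.
    + by move=> x _; rewrite lee_fin gamma_density_ge0.
    + exact: measurable_gamma_density.
    + apply/measurable_EFinP; apply: measurable_funTS.
      exact: measurable_exponential_pdf.
    + move=> x; rewrite in_itv/= andbT => x1.
      have x0 : (0 < x)%R by exact: lt_trans x1.
      rewrite lee_fin /gamma_density exponential_pdfE ?(ltW x0)//.
      rewrite mul1r mulN1r ler_piMl ?expR_ge0//.
      by rewrite -[leRHS](powRr0 x); apply: ler_powR; [exact: ltW|rewrite subr_le0 ltW].
  apply: ge0_subset_integral => //=.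
  + by apply/measurable_EFinP; exact: measurable_exponential_pdf.
  + by move=> x _; rewrite lee_fin exponential_pdf_ge0.
Qed.

Lemma Gamma_funE al : (0 < al < 1)%R ->
  (Gamma_fun al)%:E = \int[mu]_(x in `]0%R, +oo[) (gamma_density al x)%:E.
Proof.
move=> al01; rewrite /Gamma_fun /Rintegral fineK// ge0_fin_numE//.
  exact: gamma_density_integral_lty.
by apply: integral_ge0 => x _; rewrite lee_fin gamma_density_ge0.
Qed.

Lemma Gamma_fun_gt0 al : (0 < al < 1)%R -> (0 < Gamma_fun al)%R.
Proof.
move=> al01; rewrite -lte_fin Gamma_funE//.
apply: (@lt_le_trans _ _ (\int[mu]_(x in `]0%R, 1%R]) (expR (- 1))%:E)).
  rewrite integral_cst//= lebesgue_measure_itv/= lte_fin ltr01 -EFinB subr0 mule1.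
  by rewrite lte_fin expR_gt0.
apply: (@le_trans _ _ (\int[mu]_(x in `]0%R, 1%R]) (gamma_density al x)%:E)).
  apply: ge0_le_integral => //=.
  - exact: measurable_gamma_density.
  - move=> x; rewrite in_itv/= => /andP[x0 x1]; rewrite lee_fin.
    rewrite /gamma_density -[leLHS]mul1r ler_pM ?expR_ge0//; last first.
      by rewrite ler_expR lerN2.
    rewrite -[leLHS](powRr0 x); apply: ger_powR; first by rewrite x0.
    by case/andP: al01 => _ ?; rewrite subr_le0 ltW.
apply: ge0_subset_integral => //=.
- exact: measurable_gamma_density.
- by move=> x _; rewrite lee_fin gamma_density_ge0.
- by move=> x /=; rewrite !in_itv/= andbT => /andP[].
Qed.

(** The Weyl integral of order al acts on exp (-phi r) as multiplication by
    phi^(-al); this is the substitution x = phi (r - t) in the integral defining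
    Gamma. *)
Lemma weyl_exp_integral al phi t : (0 < al < 1)%R -> (0 < phi)%R ->
  \int[mu]_(r in `]t, +oo[) ((r - t) `^ (al - 1) * expR (- (phi * r)))%:E =
  (Gamma_fun al * phi `^ (- al) * expR (- (phi * t)))%:E.
Proof.
move=> al01 phi0.
have := ge0_integral_affine t phi0 (@measurable_gamma_density al setT)
  (fun x => ltac:(by rewrite lee_fin gamma_density_ge0)).
rewrite -Gamma_funE//=.
pose K := (phi `^ (al - 1) * expR (phi * t))%R.
have K0 : (0 < K)%R by rewrite mulr_gt0 ?expR_gt0 ?powR_gt0.
have mh : measurable_fun `]t, +oo[
    (fun r => ((r - t) `^ (al - 1) * expR (- (phi * r)))%:E).
  apply/measurable_EFinP; apply: measurable_funTS; apply: measurable_funM.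
    apply: (measurableT_comp (measurable_powR _)); exact: measurable_funB.
  by apply: measurableT_comp => //; apply: measurableT_comp => //; exact: measurable_funM.
have -> : \int[mu]_(r in `]t, +oo[) (gamma_density al (phi * (r - t)))%:E =
   K%:E * \int[mu]_(r in `]t, +oo[) ((r - t) `^ (al - 1) * expR (- (phi * r)))%:E.
  rewrite -ge0_integralZl//=; last 2 first.
  - by move=> x _; rewrite lee_fin mulr_ge0 ?powR_ge0 ?expR_ge0.
  - by rewrite lee_fin ltW.
  apply: eq_integral => r; rewrite inE/= in_itv/= andbT => tr.
  rewrite -EFinM; congr EFin; rewrite /gamma_density /K.
  rewrite powRM ?subr_ge0 ?(ltW phi0) ?(ltW tr)//.
  by rewrite mulrBr opprB addrC expRD; ring.
rewrite muleA -EFinM => GE.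
have c0 : (phi * K != 0)%R by rewrite gt_eqF// mulr_gt0.
set I := \int[mu]_(_ in _) _ in GE *.
transitivity ((phi * K)^-1%:E * ((phi * K)%:E * I)).
  by rewrite muleA -EFinM mulVf// mul1e.
rewrite -GE -EFinM /K mulrA mulr_powRB1 ?ltW//; last by case/andP: al01.
by rewrite powRN expRN invfM; congr EFin; ring.
Qed.

End gamma.

(** * Exchange of integrals and weighted sums *)

Section tonelli.
Context {d : measure_display} {T : measurableType d} {R : realType}.
Variables (m : {measure set T -> \bar R}) (D : set T) (mD : measurable D).
Variables (f : nat -> T -> R) (G : T -> R) (M : R).
Hypothesis mf : forall j, measurable_fun D (f j).
Hypothesis mG : measurable_fun D G.
Hypothesis f0 : forall j x, D x -> 0 <= f j x.
Hypothesis fG : forall x, D x -> l1_le (G x) (f ^~ x).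
Hypothesis GM : (\int[m]_(x in D) (G x)%:E <= M%:E)%E.

Lemma nneseries_tsum M' (a : nat -> R) : (forall j, 0 <= a j) ->
  l1_le M' a -> (\sum_(j <oo) (a j)%:E = (tsum a)%:E)%E.
Proof.
move=> a0 /l1_cvg ac; rewrite /tsum -EFin_lim//; congr (limn _).
by apply/funext => n /=; rewrite /series/= -sumEFin.
Qed.

Let int_f_le j : (\int[m]_(x in D) (f j x)%:E <= M%:E)%E.
Proof.
apply: le_trans GM; apply: ge0_le_integral => //.
- by move=> x Dx; rewrite lee_fin f0.
- exact/measurable_EFinP.
- exact/measurable_EFinP.
- move=> x Dx; rewrite lee_fin -(ger0_norm (f0 j Dx)).
  exact: (l1_le_coef j (fG Dx)).
Qed.

Lemma tonelli_integrable j : m.-integrable D (EFin \o f j).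
Proof.
apply/integrableP; split; first exact/measurable_EFinP.
apply: (@le_lt_trans _ _ M%:E); last exact: ltry.
apply: le_trans (int_f_le j); rewrite le_eqVlt; apply/orP; left; apply/eqP.
by apply: eq_integral => x; rewrite inE => Dx /=; rewrite ger0_norm// f0.
Qed.

Lemma tonelli_RintegralE j :
  (\int[m]_(x in D) f j x)%:E = (\int[m]_(x in D) (f j x)%:E)%E.
Proof. by rewrite fineK// integrable_fin_num//; exact: tonelli_integrable. Qed.

Lemma tonelli_ge0 j : 0 <= \int[m]_(x in D) f j x.
Proof. by apply: Rintegral_ge0 => x; exact: f0. Qed.

Lemma tonelli_l1_le : l1_le M (fun j => \int[m]_(x in D) f j x).
Proof.
move=> N; under eq_bigr do rewrite (ger0_norm (tonelli_ge0 _)).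
rewrite -lee_fin -sumEFin; under eq_bigr do rewrite tonelli_RintegralE.
apply: le_trans GM; rewrite -ge0_integral_sum//; last first.
  by move=> j; exact/measurable_EFinP.
apply: ge0_le_integral => //.
- by move=> x Dx; apply: sume_ge0 => j _; rewrite lee_fin f0.
- apply: emeasurable_sum => j; exact/measurable_EFinP.
- exact/measurable_EFinP.
- move=> x Dx; rewrite sumEFin lee_fin.
  apply: le_trans (fG Dx N); apply: ler_sum => j _; exact: ler_norm.
Qed.

Lemma tonelli_tsum (kap : nat -> R) : (forall j, 0 <= kap j <= 1) ->
  (tsum (fun j => kap j * \int[m]_(x in D) f j x))%:E =
  (\int[m]_(x in D) (tsum (fun j => kap j * f j x))%:E)%E.
Proof.
move=> kap01.
have kap0 j : 0 <= kap j by case/andP: (kap01 j).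
have kap1 j : `|kap j| <= 1 by rewrite ger0_norm//; case/andP: (kap01 j).
rewrite -(nneseries_tsum _ (l1_le_weight kap1 tonelli_l1_le)); last first.
  by move=> j; rewrite mulr_ge0// tonelli_ge0.
transitivity (\int[m]_(x in D) \sum_(j <oo) (kap j * f j x)%:E)%E.
  rewrite integral_nneseries//; last 2 first.
  - by move=> j; apply/measurable_EFinP; exact: measurable_funM.
  - by move=> j x Dx; rewrite lee_fin mulr_ge0// f0.
  apply: eq_eseriesr => j _; rewrite EFinM tonelli_RintegralE.
  rewrite -ge0_integralZl//.
  - exact/measurable_EFinP.
  - by move=> x Dx; rewrite lee_fin f0.
  - by rewrite lee_fin.
apply: eq_integral => x; rewrite inE => Dx.
apply: nneseries_tsum (l1_le_weight kap1 (fG Dx)) => j.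
by rewrite mulr_ge0// f0.
Qed.

End tonelli.


(** * Poisson weights and the coefficients of fractional powers *)

Section poisson_weights.
Context {R : realType}.
Implicit Types (y z : R).

Definition poisson_weight y j : R := expR (- y) * exp_coeff y j.

Lemma poisson_weight_ge0 y j : 0 <= y -> 0 <= poisson_weight y j.
Proof. by move=> y0; rewrite mulr_ge0 ?expR_ge0 ?exp_coeff_ge0. Qed.

Lemma l1_le_poisson_weight y : 0 <= y -> l1_le 1 (poisson_weight y).
Proof.
move=> y0.
have yy : `|y| <= y by rewrite ger0_norm.
have := l1_leZ (expR (- y)) (l1_le_exp_coeff yy).
by rewrite (ger0_norm (expR_ge0 _)) -expRD addNr expR0.
Qed.

Lemma gf_poisson_weight y z :
  gf z (poisson_weight y) = expR (- ((1 - z) * y)).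
Proof.
rewrite /gf.
transitivity (tsum (fun j => expR (- y) * exp_coeff (z * y) j)).
  by apply: eq_tsum => j; rewrite /poisson_weight /exp_coeff/= exprMn; ring.
rewrite (tsumZ _ (l1_le_exp_coeff (lexx _))).
rewrite -[tsum _]/(expR (z * y)).
rewrite -expRD.
by congr expR; ring.
Qed.

Lemma measurable_poisson_weight j : measurable_fun setT (poisson_weight ^~ j).
Proof.
apply: measurable_funM; first exact: measurableT_comp.
by apply: measurable_funM => //; exact: measurable_funX.
Qed.

End poisson_weights.

Section power_sequences.
Context {R : realType}.
Variables eta c : R.
Hypotheses (eta_gt0 : 0 < eta) (c_gt0 : 0 < c).
Local Notation mu := (@lebesgue_measure R).

(** The power series coefficients in z of (eta + c (1 - z))^(-al), through
    phi^(-al) = Gamma(al)^-1 times the integral of x^(al-1) exp (-phi x): the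
    factor exp (c z x) expands into Poisson weights, all of them nonnegative. *)
Definition negpow_seq (al : R) (j : nat) : R := (Gamma_fun al)^-1 *
  \int[mu]_(x in `]0, +oo[)
    (x `^ (al - 1) * expR (- (eta * x)) * poisson_weight (c * x) j).

Let rate_gt0 (z : R) : 0 < z < 1 -> 0 < eta + c * (1 - z).
Proof. by move=> /andP[z0 z1]; rewrite addr_gt0// mulr_gt0// subr_gt0. Qed.

Let gamma_integral (al phi : R) : 0 < al < 1 -> 0 < phi ->
  (\int[mu]_(x in `]0%R, +oo[) (x `^ (al - 1) * expR (- (phi * x)))%:E =
  (Gamma_fun al * phi `^ (- al))%:E)%E.
Proof.
move=> al01 phi0; have := weyl_exp_integral 0 al01 phi0.
rewrite mulr0 oppr0 expR0 mulr1 => <-.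
by apply: eq_integral => x _; rewrite addr0.
Qed.

Section negpow.
Variable al : R.
Hypothesis al01 : 0 < al < 1.

Let D : set (measurableTypeR R) := `]0, +oo[.
Let mD : measurable D := measurable_itv _.
Let f j (x : R) := x `^ (al - 1) * expR (- (eta * x)) * poisson_weight (c * x) j.
Let G (x : R) := x `^ (al - 1) * expR (- (eta * x)).

Let mG : measurable_fun D G.
Proof.
apply: measurable_funTS; apply: measurable_funM; first exact: measurable_powR.
by apply: measurableT_comp => //; apply: measurableT_comp => //; exact: measurable_funM.
Qed.

Let mf j : measurable_fun D (f j).
Proof.
apply: measurable_funM => //; apply: measurable_funTS.
by apply: (measurableT_comp (measurable_poisson_weight j)); exact: measurable_funM.
Qed.

Let D_ge0 x : D x -> 0 <= c * x.
Proof. by rewrite /D/= in_itv/= andbT => x0; rewrite mulr_ge0 ?ltW. Qed.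

Let G0 x : 0 <= G x.
Proof. by rewrite mulr_ge0 ?powR_ge0 ?expR_ge0. Qed.

Let f0 j x : D x -> 0 <= f j x.
Proof. by move=> /D_ge0 x0; rewrite mulr_ge0 ?poisson_weight_ge0 ?G0. Qed.

Let fG x : D x -> l1_le (G x) (f ^~ x).
Proof.
move=> /D_ge0 x0; have := l1_leZ (G x) (l1_le_poisson_weight x0).
by rewrite mulr1 ger0_norm.
Qed.

Let GM : (\int[mu]_(x in D) (G x)%:E <= (Gamma_fun al * eta `^ (- al))%:E)%E.
Proof. by rewrite gamma_integral. Qed.

Lemma l1_le_negpow : l1_le (eta `^ (- al)) (negpow_seq al).
Proof.
have := l1_leZ (Gamma_fun al)^-1 (tonelli_l1_le (m := mu) mD mf mG f0 fG GM).
have G0' := Gamma_fun_gt0 al01.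
by rewrite gtr0_norm ?invr_gt0// mulKf// gt_eqF.
Qed.

Lemma gf_negpow z : 0 < z < 1 ->
  gf z (negpow_seq al) = (eta + c * (1 - z)) `^ (- al).
Proof.
move=> z01; have G0' := Gamma_fun_gt0 al01.
have kap01 j : 0 <= z ^+ j <= 1.
  by case/andP: z01 => z0 z1; rewrite exprn_ge0 ?exprn_ile1// ltW.
have l1I := tonelli_l1_le (m := mu) mD mf mG f0 fG GM.
transitivity ((Gamma_fun al)^-1 *
    tsum (fun j => z ^+ j * \int[mu]_(x in D) f j x)).
  rewrite -(tsumZ _ (l1_le_gf z01 l1I)); apply: eq_tsum => j.
  by rewrite mulrCA.
suff -> : tsum (fun j => z ^+ j * \int[mu]_(x in D) f j x) =
    Gamma_fun al * (eta + c * (1 - z)) `^ (- al).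
  by rewrite mulKf// gt_eqF.
apply: EFin_inj; rewrite (tonelli_tsum (m := mu) mD mf mG f0 fG GM kap01).
rewrite -(gamma_integral al01 (rate_gt0 z01)); apply: eq_integral => x.
rewrite inE => /D_ge0 x0; congr EFin.
transitivity (G x * gf z (poisson_weight (c * x))).
  rewrite -(tsumZ _ (l1_le_gf z01 (l1_le_poisson_weight x0))).
  by apply: eq_tsum => j; rewrite mulrCA.
by rewrite gf_poisson_weight /G -mulrA -expRD; congr (_ * expR _); ring.
Qed.

End negpow.

(** The coefficients of (eta + c (1 - z))^nu, obtained as the product of
    eta + c - c z and (eta + c (1 - z))^(nu-1): the exponent 1 - nu of the second
    factor lies in ]0, 1[, where the integral representation is available. *)
Definition pow_seq (nu : R) (j : nat) : R :=
  (eta + c) * negpow_seq (1 - nu) j - c * delay (negpow_seq (1 - nu)) j.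

Section pow.
Variable nu : R.
Hypothesis nu01 : 0 < nu < 1.

Let al01 : 0 < 1 - nu < 1.
Proof. by case/andP: nu01 => nu0 nu1; rewrite subr_gt0 nu1/= ltrBlDr ltrDl. Qed.

Lemma l1_le_affine M x : l1_le M x ->
  l1_le ((eta + c) * M + c * M) (fun j => (eta + c) * x j - c * delay x j).
Proof.
move=> xM; apply: l1_leD.
  have := l1_leZ (eta + c) xM; rewrite ger0_norm//.
  by rewrite addr_ge0 ?ltW.
apply: l1_leN; have := l1_leZ c (l1_le_delay xM).
by rewrite ger0_norm ?ltW.
Qed.

Lemma gf_affine M x z : 0 < z < 1 -> l1_le M x ->
  gf z (fun j => (eta + c) * x j - c * delay x j) = (eta + c * (1 - z)) * gf z x.
Proof.
move=> z01 xM; rewrite /gf; under eq_tsum do rewrite mulrDr mulrN.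
have dM := l1_le_delay xM.
rewrite (tsumD (l1_le_gf z01 (l1_leZ (eta + c) xM))
  (l1_leN (l1_le_gf z01 (l1_leZ c dM)))).
rewrite (tsumN (l1_le_gf z01 (l1_leZ c dM))).
under eq_tsum do rewrite mulrCA; rewrite (tsumZ _ (l1_le_gf z01 xM)).
under [X in _ - X]eq_tsum do rewrite mulrCA; rewrite (tsumZ _ (l1_le_gf z01 dM)).
by rewrite -!/(gf _ _) (gf_delay z01 xM); ring.
Qed.

Lemma l1_le_pow : exists B, l1_le B (pow_seq nu).
Proof. by eexists; apply: l1_le_affine; apply: l1_le_negpow. Qed.

Lemma gf_pow z : 0 < z < 1 -> gf z (pow_seq nu) = (eta + c * (1 - z)) `^ nu.
Proof.
move=> z01; rewrite (gf_affine z01 (l1_le_negpow al01)) gf_negpow//.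
rewrite -[X in X * _]powRr1 ?ltW ?rate_gt0// -powRD; last first.
  by apply/implyP => _; rewrite gt_eqF ?rate_gt0.
by congr (_ `^ _); ring.
Qed.

End pow.
End power_sequences.

(** * The fractional operator on a family with exponential generating functions *)

Section iterated_derivatives.
Context {R : realType}.
Implicit Types (a t : R) (f u : R -> R) (G : nat -> R -> R).

Lemma near_gt0 t : 0 < t -> \forall s \near t, 0 < s.
Proof. by move=> t0; exact: lt_nbhsr. Qed.

Lemma is_derive_eq_gt0 f g t l : 0 < t -> (forall s, 0 < s -> f s = g s) ->
  is_derive t 1 g l -> is_derive t 1 f l.
Proof.
move=> t0 fg [dg gl].
have near_fg : \forall s \near t, f s = g s.
  by apply: filterS (near_gt0 t0) => s s0; exact: fg.
have near_gf : \forall s \near t, g s = f s.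
  by apply: filterS (near_gt0 t0) => s s0; rewrite fg.
split; first exact: near_eq_derivable near_gf dg.
by rewrite -gl; apply: near_eq_derive.
Qed.

Lemma iter_opp_deriveE G f :
  (forall i t, 0 < t -> is_derive t 1 (G i) (- G i.+1 t)) ->
  (forall t, 0 < t -> f t = G 0%N t) ->
  forall i t, 0 < t -> iter i opp_derive f t = G i t /\
    derivable (iter i opp_derive f) t 1.
Proof.
move=> dG fG0 i t t0.
have iterE (j : nat) (s : R) : 0 < s -> iter j opp_derive f s = G j s.
  elim: j s => [|j IH] s s0; first exact: fG0.
  have [_ dj] := is_derive_eq_gt0 s0 IH (dG j s s0).
  by rewrite iterS /opp_derive derive1E dj opprK.
split; first exact: iterE.
by have [] := is_derive_eq_gt0 t0 (iterE i) (dG i t t0).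
Qed.

Lemma is_derive_expR_linear a t :
  is_derive t 1 (fun s => expR (a * s)) (a * expR (a * t)).
Proof.
have -> : (fun s => expR (a * s)) = expR \o ( *%R a) by [].
rewrite mulrC; apply: is_derive1_comp.
rewrite -[X in is_derive _ _ _ X]mulr1.
by apply: is_deriveZ.
Qed.

(** The factor exp (a t) turns a - d/dt into - d/dt. *)
Lemma iter_shifted_deriveE a G u :
  (forall i t, 0 < t -> is_derive t 1 (G i) (- G i.+1 t)) ->
  (forall t, 0 < t -> u t = expR (a * t) * G 0%N t) ->
  forall i t, 0 < t -> iter i (shifted_derive a) u t = expR (a * t) * G i t /\
    derivable (iter i (shifted_derive a) u) t 1.
Proof.
move=> dG uG0 i t t0.
have dE (j : nat) (s : R) : 0 < s -> is_derive s 1 (fun s => expR (a * s) * G j s)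
    (a * (expR (a * s) * G j s) - expR (a * s) * G j.+1 s).
  move=> s0; have dGj := dG j s s0.
  have dP := is_deriveM (is_derive_expR_linear a s) dGj.
  apply: (is_derive_eq dP).
  by rewrite /GRing.scale/=; ring.
have iterE (j : nat) (s : R) : 0 < s ->
    iter j (shifted_derive a) u s = expR (a * s) * G j s.
  elim: j s => [|j IH] s s0; first exact: uG0.
  have [_ dj] := is_derive_eq_gt0 s0 IH (dE j s s0).
  by rewrite iterS /shifted_derive derive1E dj IH// subKr.
split; first exact: iterE.
by have [] := is_derive_eq_gt0 t0 (iterE i) (dE i t t0).
Qed.

End iterated_derivatives.
Section tempered_family.
Context {R : realType}.
Implicit Types (r s t z : R) (kap : nat -> R) (i j : nat).
Variables eta c nu : R.
Hypotheses (eta_gt0 : 0 < eta) (c_gt0 : 0 < c) (nu01 : 0 < nu < 1).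
Local Notation mu := (@lebesgue_measure R).

Let a := eta `^ nu.
Let Phi z := (eta + c * (1 - z)) `^ nu.
Let b := pow_seq eta c nu.

Variable h : R -> nat -> R.
Hypothesis h_ge0 : forall r j, 0 < r -> 0 <= h r j.
Hypothesis h_l1 : forall r, 0 < r -> l1_le (expR (- (a * r))) (h r).
Hypothesis h_gf : forall r z, 0 < r -> 0 < z < 1 ->
  gf z (h r) = expR (- (r * Phi z)).

Let gf_b z : 0 < z < 1 -> gf z b = Phi z.
Proof. exact: gf_pow. Qed.

Let a_gt0 : 0 < a.
Proof. exact: powR_gt0. Qed.

Let Phi_gt0 z : 0 < z < 1 -> 0 < Phi z.
Proof.
by move=> /andP[z0 z1]; rewrite powR_gt0// addr_gt0// mulr_gt0// subr_gt0.
Qed.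

(** Applied to w = h and to the Weyl integrals w of h, whose generating functions
    are exp (-t Phi) up to a factor C that does not depend on t. *)
Lemma is_derive_iter_conv (w : R -> nat -> R) (Mw C : R -> R) kap i t :
  (forall t, 0 < t -> l1_le (Mw t) (w t)) ->
  (forall t z, 0 < t -> 0 < z < 1 -> gf z (w t) = C z * expR (- (t * Phi z))) ->
  (forall j, `|kap j| <= 1) -> 0 < t ->
  is_derive t 1 (fun r => tsum (fun j => kap j * iter i (conv b) (w r) j))
    (- tsum (fun j => kap j * iter i.+1 (conv b) (w t) j)).
Proof.
move=> wM wC kap1 t0.
have [B bB] := l1_le_pow eta_gt0 c_gt0 nu01.
apply: (is_derive_pairing (Mw := fun r => B ^+ i * Mw r)
  (C := fun z => Phi z ^+ i * C z) bB gf_b) => //.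
- by move=> s s0; apply: l1_le_iter_conv bB (wM s s0).
- move=> s z s0 z01; rewrite (gf_iter_conv i z01 bB (wM s s0)) gf_b// wC//.
  by rewrite mulrA.
Qed.

Let h_gf1 r z : 0 < r -> 0 < z < 1 ->
  gf z (h r) = 1 * expR (- (r * Phi z)).
Proof. by move=> r0 z01; rewrite mul1r h_gf. Qed.

(** Differentiability in time gives continuity, hence measurability. *)
Lemma measurable_pairing kap t : (forall j, `|kap j| <= 1) -> 0 <= t ->
  measurable_fun `]t, +oo[ (fun r => tsum (fun j => kap j * h r j)).
Proof.
move=> kap1 t0; apply: open_continuous_measurable_fun.
  exact: interval_open.
move=> r; rewrite inE/= in_itv/= andbT => tr.
have [dr _] := is_derive_iter_conv 0 h_l1 h_gf1 kap1 (le_lt_trans t0 tr).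
by move: dr => /derivable1_diffP/differentiable_continuous.
Qed.

Let measurable_coef j t : 0 <= t -> measurable_fun `]t, +oo[ (fun r => h r j).
Proof.
move=> t0.
have k1 i : `|(i == j)%:R : R| <= 1 by case: eqP; rewrite ?normr1 ?normr0.
apply: eq_measurable_fun (measurable_pairing k1 t0) => r _.
rewrite (@tsum_finite _ _ j.+1); last first.
  by move=> i ji; rewrite gtn_eqF// mul0r.
rewrite big_nat_recr//= eqxx mul1r big_nat_cond big1 ?add0r// => i.
by rewrite andbT => /andP[_ ij]; rewrite ltn_eqF// mul0r.
Qed.

Section weyl.
Variable al : R.
Hypothesis al01 : 0 < al < 1.

(** Weyl integrals of the h_j; the factor exp (-a r) of the kernel of the operator
    is already contained in h. *)
Definition weyl_seq (t : R) (j : nat) : R := (Gamma_fun al)^-1 *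
  \int[mu]_(r in `]t, +oo[) ((r - t) `^ (al - 1) * h r j).

Section at_time.
Variable t : R.
Hypothesis t_gt0 : 0 < t.

Let D : set (measurableTypeR R) := `]t, +oo[.
Let mD : measurable D := measurable_itv _.
Let f j r := (r - t) `^ (al - 1) * h r j.
Let G r := (r - t) `^ (al - 1) * expR (- (a * r)).

Let mker : measurable_fun D (fun r : R => (r - t) `^ (al - 1)).
Proof.
apply: measurable_funTS; apply: (measurableT_comp (measurable_powR _)).
exact: measurable_funB.
Qed.

Let mG : measurable_fun D G.
Proof.
apply: measurable_funM => //; apply: measurable_funTS.
by apply: measurableT_comp => //; apply: measurableT_comp => //; exact: measurable_funM.
Qed.

Let mf j : measurable_fun D (f j).
Proof. by apply: measurable_funM => //; apply: measurable_coef; exact: ltW. Qed.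

Let D_gt0 r : D r -> 0 < r.
Proof. by rewrite /D/= in_itv/= andbT; exact: lt_trans. Qed.

Let f0 j r : D r -> 0 <= f j r.
Proof. by move=> /D_gt0 r0; rewrite mulr_ge0 ?powR_ge0 ?h_ge0. Qed.

Let fG r : D r -> l1_le (G r) (f ^~ r).
Proof.
move=> /D_gt0 r0; have := l1_leZ ((r - t) `^ (al - 1)) (h_l1 r0).
by rewrite ger0_norm ?powR_ge0.
Qed.

Let GM : (\int[mu]_(x in D) (G x)%:E
  <= (Gamma_fun al * a `^ (- al) * expR (- (a * t)))%:E)%E.
Proof. by rewrite weyl_exp_integral. Qed.

Let G_gt0 := Gamma_fun_gt0 al01.

Lemma l1_le_weyl : l1_le (a `^ (- al) * expR (- (a * t))) (weyl_seq t).
Proof.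
have := l1_leZ (Gamma_fun al)^-1 (tonelli_l1_le (m := mu) mD mf mG f0 fG GM).
by rewrite gtr0_norm ?invr_gt0// -mulrA mulKf// gt_eqF.
Qed.

Lemma pairing_weyl kap : (forall j, 0 <= kap j <= 1) ->
  (Gamma_fun al * tsum (fun j => kap j * weyl_seq t j))%:E =
  (\int[mu]_(r in `]t, +oo[)
    ((r - t) `^ (al - 1) * tsum (fun j => kap j * h r j))%:E)%E.
Proof.
move=> kap01.
have kap1 j : `|kap j| <= 1 by case/andP: (kap01 j) => ? ?; rewrite ger0_norm.
have l1I := tonelli_l1_le (m := mu) mD mf mG f0 fG GM.
transitivity (tsum (fun j => kap j * \int[mu]_(x in D) f j x))%:E.
  congr EFin.
  transitivity (Gamma_fun al * ((Gamma_fun al)^-1 *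
      tsum (fun j => kap j * \int[mu]_(x in D) f j x))).
    congr (_ * _); rewrite -(tsumZ _ (l1_le_weight kap1 l1I)).
    by apply: eq_tsum => j; rewrite mulrCA.
  by rewrite mulVKf// gt_eqF.
rewrite (tonelli_tsum (m := mu) mD mf mG f0 fG GM kap01).
apply: eq_integral => r; rewrite inE => /D_gt0 r0; congr EFin.
rewrite -(tsumZ _ (l1_le_weight kap1 (h_l1 r0))).
by apply: eq_tsum => j; rewrite mulrCA.
Qed.

Lemma gf_weyl z : 0 < z < 1 ->
  gf z (weyl_seq t) = Phi z `^ (- al) * expR (- (t * Phi z)).
Proof.
move=> z01.
have kap01 j : 0 <= z ^+ j <= 1.
  by case/andP: z01 => z0 z1; rewrite exprn_ge0 ?exprn_ile1// ltW.
apply: (mulfI (lt0r_neq0 G_gt0)); apply: EFin_inj.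
rewrite (pairing_weyl kap01) mulrA [t * _]mulrC.
rewrite -(weyl_exp_integral t al01 (Phi_gt0 z01)); apply: eq_integral => r.
rewrite inE => /D_gt0 r0; rewrite -/(gf z (h r)) h_gf//.
by rewrite [r * _]mulrC.
Qed.

Section bounded_combination.
Variables (kap : nat -> R) (u : R -> R).
Hypothesis kap01 : forall j, 0 <= kap j <= 1.
Hypothesis uE : forall r, 0 < r -> u r = expR (a * r) * tsum (fun j => kap j * h r j).

Let kap1 j : `|kap j| <= 1.
Proof. by case/andP: (kap01 j) => ? ?; rewrite ger0_norm. Qed.

Let weyl_integrandE r : D r -> weyl_integrand a al u t r =
  (r - t) `^ (al - 1) * tsum (fun j => kap j * h r j).
Proof.
move=> /D_gt0 r0; rewrite /weyl_integrand uE// mulrA -[X in X * _]mulrA -expRD.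
by rewrite addNr expR0 mulr1.
Qed.

Lemma integrable_weyl_integrand :
  mu.-integrable `]t, +oo[ (EFin \o weyl_integrand a al u t).
Proof.
have mw : measurable_fun D (weyl_integrand a al u t).
  apply: (@eq_measurable_fun _ _ _ _ _ (fun r =>
    (r - t) `^ (al - 1) * tsum (fun j => kap j * h r j))).
    by move=> r; rewrite inE => Dr; rewrite weyl_integrandE.
  apply: measurable_funM => //; apply: measurable_pairing => //; exact: ltW.
apply/integrableP; split; first exact/measurable_EFinP.
have -> : (\int[mu]_(r in `]t, +oo[) `|(EFin \o weyl_integrand a al u t) r| =
    \int[mu]_(r in `]t, +oo[)
      ((r - t) `^ (al - 1) * tsum (fun j => kap j * h r j))%:E)%E.
  apply: eq_integral => r; rewrite inE => Dr /=.
  rewrite weyl_integrandE// ger0_norm// mulr_ge0 ?powR_ge0//.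
  by apply: tsum_ge0 => j; rewrite mulr_ge0 ?h_ge0 ?D_gt0//; case/andP: (kap01 j).
by rewrite -pairing_weyl// ltry.
Qed.

Lemma weyl_integralE : weyl_integral a al u t = tsum (fun j => kap j * weyl_seq t j).
Proof.
apply: (mulfI (lt0r_neq0 G_gt0)); rewrite /weyl_integral mulVKf ?gt_eqF//.
apply: EFin_inj; rewrite (pairing_weyl kap01).
have -> : (\int[mu]_(r in `]t, +oo[) ((r - t) `^ (al - 1) *
    tsum (fun j => kap j * h r j))%:E =
    \int[mu]_(r in `]t, +oo[) (weyl_integrand a al u t r)%:E)%E.
  by apply: eq_integral => r; rewrite inE => Dr; rewrite weyl_integrandE.
by rewrite fineK// integrable_fin_num//; exact: integrable_weyl_integrand.
Qed.

End bounded_combination.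
End at_time.
End weyl.

(** The generating functions give Phi^m Phi^(-al) = Phi^(1/nu) =
    eta + c (1 - z): the fractional power collapses to a polynomial of degree 1
    in z. With al = 0 this covers integer 1/nu. *)
Lemma iter_conv_pow (x : nat -> R) M (m : nat) al t : 0 < t ->
  m%:R - al = 1 / nu -> l1_le M x ->
  (forall z, 0 < z < 1 -> gf z x = Phi z `^ (- al) * expR (- (t * Phi z))) ->
  iter m (conv b) x = fun j => (eta + c) * h t j - c * delay (h t) j.
Proof.
move=> t0 malE xM xE.
have [B bB] := l1_le_pow eta_gt0 c_gt0 nu01.
apply: (gf_inj (l1_le_iter_conv m bB xM)
  (l1_le_affine eta_gt0 c_gt0 (h_l1 t0))) => z z01.
have rate0 : 0 <= eta + c * (1 - z).
  by case/andP: z01 => ? z1; rewrite addr_ge0 ?ltW// mulr_gt0// subr_gt0.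
rewrite (gf_affine eta c z01 (h_l1 t0)) h_gf//.
rewrite (gf_iter_conv m z01 bB xM) gf_b// xE// mulrA; congr (_ * _).
rewrite -powR_mulrn ?ltW ?Phi_gt0// -powRD; last first.
  by apply/implyP => _; rewrite gt_eqF ?Phi_gt0.
rewrite malE /Phi -powRrM mulrCA mulfV ?mulr1 ?powRr1//.
by case/andP: nu01 => n0 _; rewrite gt_eqF.
Qed.

(** On h, the operator (a - d/dt)^(1/nu) acts as m convolutions with b after a
    Weyl integral of order al = m - 1/nu, or as 1/nu convolutions with b when
    1/nu is an integer. *)
Theorem frac_shifted_derive_tempered kap (u : R -> R) :
  (forall j, 0 <= kap j <= 1) ->
  (forall r, 0 < r -> u r = expR (a * r) * tsum (fun j => kap j * h r j)) ->
  frac_shifted_derivable a (1 / nu) u /\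
  forall t, 0 < t -> frac_shifted_derive a (1 / nu) u t =
    expR (a * t) *
    tsum (fun j => kap j * ((eta + c) * h t j - c * delay (h t) j)).
Proof.
move=> kap01 uE.
have kap1 j : `|kap j| <= 1 by case/andP: (kap01 j) => ? ?; rewrite ger0_norm.
have beta0 : 0 <= 1 / nu by case/andP: nu01 => n0 _; rewrite divr_ge0// ltW.
rewrite /frac_shifted_derivable /frac_shifted_derive.
case: ifPn => [beta_nat|beta_nat].
  have betaE : (Num.truncn (1 / nu))%:R = 1 / nu by exact: truncnK.
  set m := Num.truncn (1 / nu) in betaE *.
  pose G i t := tsum (fun j => kap j * iter i (conv b) (h t) j).
  have dG i t : 0 < t -> is_derive t 1 (G i) (- G i.+1 t).
    exact: is_derive_iter_conv h_l1 h_gf1 kap1.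
  split=> [i t im t0|t t0]; first by have [] := iter_shifted_deriveE dG uE i t0.
  have [-> _] := iter_shifted_deriveE dG uE m t0.
  rewrite /G (@iter_conv_pow _ (expR (- (a * t))) m 0 t)//.
  - by rewrite subr0.
  - exact: h_l1.
  - by move=> z z01; rewrite oppr0 powRr0 mul1r h_gf.
set m := (Num.truncn (1 / nu)).+1; set al := m%:R - 1 / nu.
have al01 : 0 < al < 1.
  have /andP[tb bt] := truncn_itv beta0.
  rewrite subr_gt0 bt/= /al /m -natr1 addrAC gtrDr subr_lt0 lt_neqAle tb andbT.
  by rewrite -natrEtruncn.
pose G i t := tsum (fun j => kap j * iter i (conv b) (weyl_seq al t) j).
have w_l1 t : 0 < t -> l1_le (a `^ (- al) * expR (- (a * t))) (weyl_seq al t).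
  exact: l1_le_weyl.
have w_gf t z : 0 < t -> 0 < z < 1 ->
    gf z (weyl_seq al t) = Phi z `^ (- al) * expR (- (t * Phi z)).
  by move=> t0 z01; exact: gf_weyl.
have dG i t : 0 < t -> is_derive t 1 (G i) (- G i.+1 t).
  exact: (is_derive_iter_conv i w_l1 (C := fun z => Phi z `^ (- al)) w_gf kap1).
have WG0 t : 0 < t -> weyl_integral a al u t = G 0%N t.
  by move=> t0; rewrite (weyl_integralE al01 t0 kap01 uE).
split; first split.
- by move=> t t0; exact: (integrable_weyl_integrand al01 t0 kap01 uE).
- by move=> i t im t0; have [] := iter_opp_deriveE dG WG0 i t0.
move=> t t0; have [-> _] := iter_opp_deriveE dG WG0 m t0.
rewrite /G (@iter_conv_pow _ (a `^ (- al) * expR (- (a * t))) m al t)//.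
- by rewrite /al subKr.
- exact: w_l1.
- by move=> z z01; exact: w_gf.
Qed.

End tempered_family.

(** * Poisson weights at the time of the subordinator *)

Section subordinated_poisson.
Context {d : measure_display} {T : measurableType d} {R : realType}.
Variables (P : probability T R) (eta nu c : R) (D : R -> T -> R).
Hypotheses (c_gt0 : 0 < c).
Hypothesis D_tss : tempered_stable_subordinator P eta nu D.

Let a := eta `^ nu.

(** The probability of j events of a Poisson process of rate c before D t, damped
    so that no constant remains in the exponent of its generating function. *)
Definition subordinated_weight (t : R) (j : nat) : R :=
  expR (- (a * t)) * \int[P]_w poisson_weight (c * D t w) j.

Lemma tss_ge0 t w : 0 <= t -> 0 <= D t w.
Proof.
case: D_tss => -[_ D0 Dnd _ _ _] _ t0.
by rewrite -(D0 w); exact: Dnd.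
Qed.

Section at_time.
Variable t : R.
Hypothesis t_ge0 : 0 <= t.

Let f j w := poisson_weight (c * D t w) j.
Let G : T -> R := cst 1.

Let mD : measurable_fun setT (D t).
Proof. by case: D_tss => -[+ _ _ _ _ _] _; exact. Qed.

Let mf j : measurable_fun setT (f j).
Proof.
by apply: (measurableT_comp (measurable_poisson_weight j)); exact: measurable_funM.
Qed.

Let mG : measurable_fun setT G. Proof. exact: measurable_cst. Qed.

Let f0 j w : setT w -> 0 <= f j w.
Proof.
by move=> _; rewrite poisson_weight_ge0// mulr_ge0 ?tss_ge0 ?(ltW c_gt0).
Qed.

Let fG w : setT w -> l1_le (G w) (f ^~ w).
Proof.
by move=> _; apply: l1_le_poisson_weight; rewrite mulr_ge0 ?tss_ge0 ?(ltW c_gt0).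
Qed.

Let GM : (\int[P]_(w in setT) (G w)%:E <= 1%:E)%E.
Proof. by rewrite (eq_integral (cst 1%E))// integral_cst//= probability_setT mule1. Qed.

Let l1f : l1_le 1 (fun j => \int[P]_w f j w).
Proof. exact: (tonelli_l1_le (m := P) measurableT mf mG f0 fG GM). Qed.

Lemma subordinated_weight_ge0 j : 0 <= subordinated_weight t j.
Proof.
by rewrite mulr_ge0 ?expR_ge0//; apply: Rintegral_ge0 => w Tw; exact: f0.
Qed.

Lemma l1_le_subordinated : l1_le (expR (- (a * t))) (subordinated_weight t).
Proof.
by have := l1_leZ (expR (- (a * t))) l1f; rewrite mulr1 ger0_norm ?expR_ge0.
Qed.

Lemma tsum_subordinated kap : (forall j, 0 <= kap j <= 1) ->
  (tsum (fun j => kap j * subordinated_weight t j))%:E =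
  ((expR (- (a * t)))%:E *
    \int[P]_w (tsum (fun j => kap j * poisson_weight (c * D t w) j))%:E)%E.
Proof.
move=> kap01.
have kap1 j : `|kap j| <= 1 by case/andP: (kap01 j) => ? ?; rewrite ger0_norm.
rewrite -(tonelli_tsum (m := P) measurableT mf mG f0 fG GM kap01) -EFinM.
rewrite -(tsumZ _ (l1_le_weight kap1 l1f)); congr EFin.
by apply: eq_tsum => j; rewrite mulrCA.
Qed.

End at_time.

(** Summing the Poisson weights turns the expectation into the Laplace transform
    of D t at c (1 - z). *)
Lemma gf_subordinated t z : 0 < t -> 0 < z < 1 ->
  gf z (subordinated_weight t) = expR (- (t * (eta + c * (1 - z)) `^ nu)).
Proof.
move=> t0 z01; have t0' := ltW t0.
have kap01 j : 0 <= z ^+ j <= 1.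
  by case/andP: z01 => z0 z1; rewrite exprn_ge0 ?exprn_ile1// ltW.
have s0 : 0 < c * (1 - z).
  by case/andP: z01 => _ z1; rewrite mulr_gt0// subr_gt0.
apply: EFin_inj; rewrite /gf (tsum_subordinated t0' kap01).
have -> : (\int[P]_w (tsum (fun j => z ^+ j * poisson_weight (c * D t w) j))%:E
    = 'E_P[fun w => expR (- (c * (1 - z) * D t w))])%E.
  rewrite unlock; apply: eq_integral => w _; congr EFin.
  rewrite -[LHS]/(gf z _) gf_poisson_weight.
  by congr expR; ring.
case: D_tss => _ ->//; rewrite -EFinM -expRD; congr (EFin (expR _)).
by rewrite /a; ring.
Qed.

End subordinated_poisson.

(** * The jump chain of the Skellam process *)

Section jump_operators.
Context {R : realType}.
Variable k : nat.
Hypothesis k_gt0 : (0 < k)%N.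
Implicit Types (f g : int -> R) (s n : int).

(** The mean of f over one uniform jump in the direction s, which is 1 or -1. *)
Definition avg s f n : R := k%:R^-1 * \sum_(1 <= v < k.+1) f (n + s * v%:Z).

Definition delta0 n : R := (n == 0)%:R.

Let k0 : k%:R != 0 :> R.
Proof. by rewrite pnatr_eq0 -lt0n. Qed.

Lemma avgC s s' f : avg s (avg s' f) = avg s' (avg s f).
Proof.
apply/funext => n; rewrite /avg; congr (_ * _).
under eq_bigr do rewrite mulr_sumr; under [RHS]eq_bigr do rewrite mulr_sumr.
rewrite exchange_big; apply: eq_bigr => v _; apply: eq_bigr => v' _.
by rewrite addrAC.
Qed.

Lemma avg_iterC i s s' f : avg s (iter i (avg s') f) = iter i (avg s') (avg s f).
Proof. by elim: i => //= i IH; rewrite avgC IH. Qed.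

Lemma avg_bounds s f : (forall n, 0 <= f n <= 1) -> forall n, 0 <= avg s f n <= 1.
Proof.
move=> f01 n; rewrite /avg; apply/andP; split.
  rewrite mulr_ge0 ?invr_ge0// sumr_ge0// => v _.
  by case/andP: (f01 (n + s * v%:Z)).
rewrite mulrC ler_pdivrMr ?ltr0n// mul1r.
apply: (@le_trans _ _ (\sum_(1 <= v < k.+1) 1)).
  by apply: ler_sum => v _; case/andP: (f01 (n + s * v%:Z)).
by rewrite big_const_nat iter_addr_0 subn1.
Qed.

Lemma delta0_bounds n : 0 <= delta0 n <= 1.
Proof. by rewrite /delta0; case: eqP; rewrite !(lexx, ler01). Qed.

Lemma iter_avg_bounds i s f : (forall n, 0 <= f n <= 1) ->
  forall n, 0 <= iter i (avg s) f n <= 1.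
Proof. by move=> f01; elim: i => //= i IH; exact: avg_bounds. Qed.

Lemma avgZ s f (x : R) : avg s (fun n => x * f n) = (fun n => x * avg s f n).
Proof.
by apply/funext => n; rewrite /avg -mulr_sumr mulrCA.
Qed.

Lemma avg_sum s (I : Type) (r : seq I) (F : I -> int -> R) :
  avg s (fun n => \sum_(i <- r) F i n) = (fun n => \sum_(i <- r) avg s (F i) n).
Proof.
by apply/funext => n; rewrite /avg exchange_big/= mulr_sumr.
Qed.

Lemma avg_tsum s (F : nat -> int -> R) (m : R) : (forall n, l1_le m (F ^~ n)) ->
  avg s (fun n => tsum (F ^~ n)) = (fun n => tsum (fun i => avg s (F i) n)).
Proof.
move=> Fm; apply/funext => n.
have l1 (v : nat) : l1_le m (fun i => F i (n + s * v%:Z)) by exact: Fm.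
rewrite /avg big_add1/= -(tsum_sum k (fun v => l1 v.+1)).
rewrite -(tsumZ _ (l1_le_sum k (fun v => l1 v.+1))).
by apply: eq_tsum => i; rewrite big_add1.
Qed.

Lemma l1_le_avg s (F : nat -> int -> R) (m : R) : (forall n, l1_le m (F ^~ n)) ->
  forall n, l1_le m (fun i => avg s (F i) n).
Proof.
move=> Fm n.
have l1 (v : nat) : l1_le m (fun i => F i (n + s * v%:Z)) by exact: Fm.
have := l1_leZ (k%:R^-1) (l1_le_sum k (fun v => l1 v.+1)).
rewrite ger0_norm ?invr_ge0// big_const_nat iter_addr_0 subn0 -[m *+ k]mulr_natl mulKf//.
by apply: l1_le_dom => i; rewrite /avg big_add1.
Qed.

Definition jump_law a : int -> R := iter a (avg (- 1)) delta0.

Lemma jump_law_bounds a n : 0 <= jump_law a n <= 1.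
Proof. exact: iter_avg_bounds delta0_bounds n. Qed.

Lemma jump_law_lt0 a n : n < 0 -> jump_law a n = 0.
Proof.
elim: a n => [|a IH] n n0; first by rewrite /= /delta0 lt_eqF.
rewrite /= /avg big1 ?mulr0// => v _; apply: IH.
by rewrite mulN1r (le_lt_trans _ n0)// gerBl.
Qed.

Lemma iter_delay_jump_law a v (l : nat) :
  iter v delay (fun l : nat => jump_law a l) l = jump_law a (l%:Z + - 1 * v%:Z).
Proof.
rewrite iter_delayE mulN1r; case: leqP => [vl|lv]; first by rewrite subzn.
by rewrite jump_law_lt0// subr_lt0 ltz_nat.
Qed.

Lemma l1_le_jump_law a : l1_le 1 (fun l : nat => jump_law a l).
Proof.
elim: a => [|a IH].
  move=> [|N]; first by rewrite big_nil.
  rewrite big_nat_recl//= big1 ?addr0; last by move=> i _; rewrite normr0.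
  by rewrite /delta0 eqxx normr1.
have := l1_leZ (k%:R^-1) (l1_le_sum k (fun v => l1_le_iter_delay v.+1 IH)).
rewrite ger0_norm ?invr_ge0// big_const_nat iter_addr_0 subn0 mulVf//.
apply: l1_le_dom => l; rewrite /= /avg big_add1/=.
by under [in leRHS]eq_bigr do rewrite -/(iter _.+1 _ _) iter_delay_jump_law.
Qed.

(** Averaging over b backward jumps of the subtracted variable is averaging f over
    b forward jumps. *)
Lemma tsum_jump_law b f n : (forall n, `|f n| <= 1) ->
  tsum (fun l : nat => f (n + l%:Z) * jump_law b l) = iter b (avg 1) f n.
Proof.
move=> f1; elim: b n => [|b IH] n.
  rewrite (@tsum_finite _ _ 1).
    by rewrite big_nat1 /= /delta0 eqxx mulr1 addr0.
  by move=> [|j]//= _; rewrite /delta0 mulr0.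
have fl1 v : l1_le 1 (fun l : nat => f (n + l%:Z) * jump_law b (l%:Z + - 1 * v%:Z)).
  apply: l1_le_weight => //; have := l1_le_iter_delay v (l1_le_jump_law b).
  by apply: l1_le_dom => l; rewrite iter_delay_jump_law.
transitivity (tsum (fun l : nat => k%:R^-1 * \sum_(0 <= v < k)
    (f (n + l%:Z) * jump_law b (l%:Z + - 1 * v.+1%:Z)))).
  apply: eq_tsum => l; rewrite {1}/jump_law iterS -/(jump_law b) /avg big_add1/=.
  by rewrite mulrCA mulr_sumr.
rewrite (tsumZ _ (l1_le_sum k (fun v => fl1 v.+1))) (tsum_sum k (fun v => fl1 v.+1)).
rewrite iterS /avg big_add1/=; congr (_ * _); apply: eq_bigr => v _.
rewrite -IH mul1r.
have := tsum_tail v.+1 (fl1 v.+1); rewrite big_nat_cond big1 ?subr0 => [<-|l].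
  apply: eq_tsum => l; congr (f _ * jump_law b _).
    by rewrite PoszD addrA addrAC.
  by rewrite mulN1r PoszD addrK.
rewrite andbT => /andP[_ lv]; rewrite jump_law_lt0 ?mulr0//.
by rewrite mulN1r subr_lt0 ltz_nat.
Qed.

Lemma iter_avg_tsum b (F : nat -> int -> R) (m : R) : (forall n, l1_le m (F ^~ n)) ->
  (forall n, l1_le m (fun i => iter b (avg 1) (F i) n)) /\
  iter b (avg 1) (fun n => tsum (F ^~ n)) =
    (fun n => tsum (fun i => iter b (avg 1) (F i) n)).
Proof.
move=> Fm; elim: b => //= b [IH1 IH2]; split; first exact: l1_le_avg.
by rewrite IH2 (avg_tsum _ IH1).
Qed.

End jump_operators.

Section skellam_jumps.
Context {R : realType}.
Variables (k : nat) (lambda1 lambda2 : R).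
Hypotheses (k_gt0 : (0 < k)%N) (lambda1_gt0 : 0 < lambda1) (lambda2_gt0 : 0 < lambda2).

Let c := k%:R * (lambda1 + lambda2).

(** One jump of the Skellam process: at the total rate c, a jump of N1 has
    probability k lambda1 / c and a jump of N2 has probability k lambda2 / c. *)
Definition skellam_step (f : int -> R) n : R :=
  c^-1 * (k%:R * lambda1 * avg k (- 1) f n + k%:R * lambda2 * avg k 1 f n).

Definition skellam_law j : int -> R := iter j skellam_step (@delta0 R).

Let kR0 : 0 < k%:R :> R. Proof. by rewrite ltr0n. Qed.

Let c_gt0 : 0 < c. Proof. by rewrite mulr_gt0// addr_gt0. Qed.

Lemma skellam_law_bounds j n : 0 <= skellam_law j n <= 1.
Proof.
elim: j n => [|j IH] n; first exact: delta0_bounds.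
rewrite /skellam_law iterS -/(skellam_law j) /skellam_step.
have /andP[b0 b1] := avg_bounds k_gt0 (- 1) IH n.
have /andP[f0 f1] := avg_bounds k_gt0 1 IH n.
have k1 : 0 < k%:R * lambda1 by rewrite mulr_gt0.
have k2 : 0 < k%:R * lambda2 by rewrite mulr_gt0.
apply/andP; split.
  apply: mulr_ge0; first by rewrite invr_ge0 ltW.
  by apply: addr_ge0; apply: mulr_ge0 => //; exact: ltW.
rewrite mulrC ler_pdivrMr// mul1r /c mulrDr.
by apply: lerD; rewrite ler_piMr// ltW.
Qed.

Lemma skellam_stepE f n : c * skellam_step f n =
  lambda1 * (\sum_(1 <= j < k.+1) f (n - j%:Z)) +
  lambda2 * (\sum_(1 <= j < k.+1) f (n + j%:Z)).
Proof.
rewrite /skellam_step mulVKf ?gt_eqF// /avg.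
have kE (x y : R) : k%:R * x * (k%:R^-1 * y) = x * y.
  by field; rewrite gt_eqF.
rewrite !kE; congr (_ * _ + _ * _); apply: eq_bigr => v _.
  by rewrite mulN1r.
by rewrite mul1r.
Qed.

Section poisson_mixture.
Variable x : R.
Let y1 := k%:R * lambda1 * x.
Let y2 := k%:R * lambda2 * x.
Let V a b := iter b (avg k 1) (jump_law (R := R) k a).
(* the mixture of the V a b over a + b = j, without the factor exp (-(y1 + y2)) *)
Let Y j n := \sum_(0 <= b < j.+1)
  exp_coeff y2 b * exp_coeff y1 (j - b)%N * V (j - b)%N b n.

Let exp_coeffS (y : R) i : i.+1%:R * exp_coeff y i.+1 = y * exp_coeff y i.
Proof.
rewrite /exp_coeff/= exprS factS natrM; field.
by rewrite nat1r !pnatr_eq0 -lt0n fact_gt0.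
Qed.

(* Splitting the factor j + 1 as b + (j + 1 - b) yields a recurrence in j, which
   replaces the binomial formula for commuting operators. *)
Let YS j n : j.+1%:R * Y j.+1 n = c * x * skellam_step (Y j) n.
Proof.
transitivity (y2 * avg k 1 (Y j) n + y1 * avg k (- 1) (Y j) n).
  rewrite /Y !avg_sum !mulr_sumr.
  transitivity (\sum_(0 <= b < j.+2)
      (b%:R * exp_coeff y2 b * exp_coeff y1 (j.+1 - b)%N * V (j.+1 - b)%N b n) +
    \sum_(0 <= b < j.+2)
      ((j.+1 - b)%:R * exp_coeff y1 (j.+1 - b)%N * exp_coeff y2 b * V (j.+1 - b)%N b n)).
    rewrite -big_split/= big_nat_cond [RHS]big_nat_cond.
    apply: eq_bigr => b; rewrite andbT ltnS => /andP[_ bj].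
    have -> : j.+1%:R = (j.+1 - b)%:R + b%:R :> R by rewrite -natrD subnK.
    by ring.
  congr (_ + _).
    rewrite big_nat_recl//= !mul0r add0r; apply: eq_bigr => b _.
    by rewrite subSS exp_coeffS /= avgZ; ring.
  rewrite big_nat_recr//= subnn !mul0r addr0.
  rewrite big_nat_cond [RHS]big_nat_cond; apply: eq_bigr => b.
  rewrite andbT => /andP[_ bj]; rewrite ltnS in bj.
  rewrite subSn// exp_coeffS avgZ /V avg_iterC /=; ring.
rewrite /skellam_step /y1 /y2.
by field; rewrite gt_eqF.
Qed.

Lemma poisson_mixture_coef j n :
  \sum_(0 <= b < j.+1) poisson_weight y2 b *
    (poisson_weight y1 (j - b)%N * V (j - b)%N b n) =
  poisson_weight (c * x) j * skellam_law j n.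
Proof.
have YE : Y j n = exp_coeff (c * x) j * skellam_law j n.
  elim: j n => [|j IH] n.
    by rewrite /Y big_nat1 /exp_coeff/= !expr0 !divr1 !mul1r.
  have j0 : j.+1%:R != 0 :> R by rewrite pnatr_eq0.
  apply: (mulfI j0); rewrite YS [in RHS]mulrA exp_coeffS.
  have -> : Y j = (fun n => exp_coeff (c * x) j * skellam_law j n).
    by apply/funext.
  by rewrite /skellam_step !avgZ /skellam_law iterS /skellam_step -/(skellam_law j); ring.
rewrite /poisson_weight -mulrA -YE mulr_sumr; apply: eq_bigr => b _.
have -> : - (c * x) = - y2 + - y1 by rewrite /c /y1 /y2; ring.
by rewrite expRD; ring.
Qed.

End poisson_mixture.

(** The two independent Poisson numbers of jumps, a forward and b backward, are
    grouped by their sum j, which is Poisson with parameter c x. *)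
Lemma poisson_mixture x n : 0 <= x ->
  tsum (fun b => poisson_weight (k%:R * lambda2 * x) b *
    tsum (fun a => poisson_weight (k%:R * lambda1 * x) a *
      iter b (avg k 1) (jump_law k a) n)) =
  tsum (fun j => skellam_law j n * poisson_weight (c * x) j).
Proof.
move=> x0.
set y1 := k%:R * lambda1 * x; set y2 := k%:R * lambda2 * x.
have y10 : 0 <= y1 by rewrite !mulr_ge0// ltW.
have y20 : 0 <= y2 by rewrite !mulr_ge0// ltW.
pose g b a := poisson_weight y2 b *
  (poisson_weight y1 a * iter b (avg k 1) (jump_law k a) n).
have V1 a b : `|iter b (avg k 1) (jump_law (R := R) k a) n| <= 1.
  have /andP[V0 V1] : 0 <= iter b (avg k 1) (jump_law (R := R) k a) n <= 1.
    by apply: iter_avg_bounds => // m; exact: jump_law_bounds.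
  by rewrite ger0_norm.
have l1V b : l1_le 1 (fun a => poisson_weight y1 a * iter b (avg k 1) (jump_law k a) n).
  apply: l1_le_dom (l1_le_poisson_weight y10) => a.
  by rewrite normrM ler_piMr.
have l1g b : l1_le (poisson_weight y2 b) (g b).
  have := l1_leZ (poisson_weight y2 b) (l1V b).
  by rewrite mulr1 ger0_norm// poisson_weight_ge0.
transitivity (tsum (fun b => tsum (iter b delay (g b)))).
  apply: eq_tsum => b; rewrite (tsum_iter_delay _ (l1g b)).
  by rewrite (tsumZ _ (l1V b)).
rewrite -(tsum_exchange (fun b => l1_le_iter_delay b (l1g b)) (l1_le_poisson_weight y20)).
apply: eq_tsum => j; rewrite mulrC -poisson_mixture_coef.
rewrite (@tsum_finite _ _ j.+1); last first.
  by move=> b jb; rewrite iter_delayE leqNgt jb.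
rewrite big_nat_cond [RHS]big_nat_cond; apply: eq_bigr => b.
by rewrite andbT ltnS iter_delayE => /andP[_ ->].
Qed.

End skellam_jumps.

(** * Sums of independent uniform jumps *)

Section real_probability.
Context {d : measure_display} {T : measurableType d} {R : realType}.
Variable P : probability T R.

Definition prob (A : set T) : R := fine (P A).

Lemma prob_EFin A : measurable A -> (prob A)%:E = P A.
Proof. by move=> mA; rewrite fineK// fin_num_measure. Qed.

Lemma prob_ge0 A : 0 <= prob A.
Proof. by rewrite fine_ge0. Qed.

Lemma prob_setT : prob setT = 1.
Proof. by rewrite /prob probability_setT. Qed.

Let total_eseries A (Y : T -> nat) : measurable A ->
  (forall v, measurable [set w | Y w = v]) ->
  (P A = \sum_(v <oo) (prob (A `&` [set w | Y w = v]))%:E)%E.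
Proof.
move=> mA mY.
have mAY v : measurable (A `&` [set w | Y w = v]) by exact: measurableI.
have AE : A = \bigcup_v (A `&` [set w | Y w = v]).
  by apply/seteqP; split=> [w Aw|w [v _ []]//]; exists (Y w).
rewrite {1}AE measure_bigcup//.
  by rewrite eseries_mkcond; apply: eq_eseriesr => v _; rewrite in_setT prob_EFin.
by move=> i j _ _ [w [[_ <-] [_ <-]]].
Qed.

Lemma l1_le_total A (Y : T -> nat) : measurable A ->
  (forall v, measurable [set w | Y w = v]) ->
  l1_le (prob A) (fun v => prob (A `&` [set w | Y w = v])).
Proof.
move=> mA mY N; under eq_bigr do rewrite (ger0_norm (prob_ge0 _)).
rewrite -lee_fin -sumEFin (prob_EFin mA) (total_eseries mA mY).
by apply: nneseries_lim_ge => v _; rewrite lee_fin prob_ge0.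
Qed.

Lemma total_probability A (Y : T -> nat) : measurable A ->
  (forall v, measurable [set w | Y w = v]) ->
  prob A = tsum (fun v => prob (A `&` [set w | Y w = v])).
Proof.
move=> mA mY; apply: EFin_inj; rewrite (prob_EFin mA) (total_eseries mA mY).
apply: nneseries_tsum (l1_le_total mA mY) => v; exact: prob_ge0.
Qed.

End real_probability.

Section jump_sums.
Context {d : measure_display} {T : measurableType d}.

Lemma sum_jumpsS (X : nat -> T -> nat) a (z : int) :
  [set w | (\sum_(i < a.+1) X i w)%N%:Z = z] = \bigcup_v
    ([set w | (\sum_(i < a) X i w)%N%:Z = z - v%:Z] `&` [set w | X a w = v]).
Proof.
apply/seteqP; split=> w /=.
  move=> <-; exists (X a w) => //=; split => //.
  by rewrite big_ord_recr/= PoszD addrK.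
by move=> [v _ /= [sz Xv]]; rewrite big_ord_recr/= PoszD sz Xv subrK.
Qed.

Lemma measurable_sum_jumps (X : nat -> T -> nat) :
  (forall i v, measurable [set w | X i w = v]) ->
  forall a (z : int), measurable [set w | (\sum_(i < a) X i w)%N%:Z = z].
Proof.
move=> mX; elim=> [|a IH] z; last first.
  by rewrite sum_jumpsS; apply: bigcupT_measurable => v; exact: measurableI.
have [->|z0] := eqVneq z 0.
  rewrite (_ : [set _ | _] = setT)//; apply/seteqP; split=> // w _ /=.
  by rewrite big_ord0.
rewrite (_ : [set _ | _] = set0)//; apply/seteqP; split=> // w /=.
by rewrite big_ord0 => z0'; move: z0; rewrite -z0' eqxx.
Qed.

Lemma measurable_preimage_nat (Y : T -> nat) : measurable_fun setT Y ->
  forall v, measurable [set w | Y w = v].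
Proof.
move=> mY v; rewrite -[X in measurable X]setTI.
exact: (mY measurableT [set v]).
Qed.

End jump_sums.

Section uniform_jumps.
Context {d : measure_display} {T : measurableType d} {R : realType}.
Variables (P : probability T R) (k : nat) (X : nat -> T -> nat).
Hypotheses (k_gt0 : (0 < k)%N) (Xiid : iid_uniform P k X).

Let mX i v : measurable [set w | X i w = v].
Proof. by case: Xiid => mX _ _; exact: measurable_preimage_nat. Qed.

Let kR0 : k%:R != 0 :> R. Proof. by rewrite pnatr_eq0 -lt0n. Qed.

Let prob_jump i v : (1 <= v <= k)%N -> prob P [set w | X i w = v] = k%:R^-1.
Proof. by case: Xiid => _ _ Xk /(Xk i v); rewrite /prob => ->. Qed.

(* The values 1..k already carry total mass 1. *)
Let prob_jump0 i v : ~~ (1 <= v <= k)%N -> prob P [set w | X i w = v] = 0.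
Proof.
move=> vk; apply/eqP; rewrite eq_le prob_ge0 andbT.
have := l1_le_total P measurableT (mX i) (maxn k v).+1.
under eq_bigr do rewrite setTI (ger0_norm (prob_ge0 _ _)).
rewrite prob_setT => sum_le.
have : \sum_(0 <= u < (maxn k v).+1)
    ((u == v)%:R * prob P [set w | X i w = v] + (1 <= u <= k)%N%:R * k%:R^-1) <= 1.
  apply: le_trans sum_le; apply: ler_sum => u _.
  have [->|uv] := eqVneq u v; first by rewrite (negbTE vk) mul1r mul0r addr0.
  rewrite mul0r add0r; case: (boolP (1 <= u <= k)%N) => uk.
    by rewrite mul1r prob_jump.
  by rewrite mul0r prob_ge0.
rewrite big_split/= -!mulr_suml.
have -> : \sum_(0 <= u < (maxn k v).+1) (u == v)%:R = 1 :> R.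
  rewrite (bigD1_seq v) ?iota_uniq ?mem_index_iota ?ltnS ?leq_maxr//= eqxx.
  by rewrite big1 ?addr0// => u /negbTE ->.
have -> : \sum_(0 <= u < (maxn k v).+1) (1 <= u <= k)%N%:R = k%:R :> R.
  rewrite big_nat_recl//= add0r (@big_cat_nat _ _ _ k)//= ?leq_maxl//.
  rewrite [X in _ + X]big_nat_cond [X in _ + X]big1 ?addr0; last first.
    by move=> u; rewrite andbT => /andP[ku _]; rewrite ltnNge ku.
  rewrite big_nat_cond (eq_bigr (fun=> 1)); last first.
    by move=> u; rewrite andbT => /andP[_ ->].
  by rewrite -big_nat_cond big_const_nat iter_addr_0 subn0.
by rewrite mulfV// mul1r gerDr.
Qed.

Let fixed (s : seq nat) (v : nat -> nat) : set T :=
  \big[setI/setT]_(i <- s) [set w | X i w = v i].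

Let mfixed s v : measurable (fixed s v).
Proof. by apply: bigsetI_measurable => i _; exact: mX. Qed.

(* The induction carries along the values of finitely many later jumps: this is
   the form in which mutual independence can be used once the last jump of the
   sum has been fixed. *)
Let prob_sum_fixed a z s v : uniq s -> (forall i, i \in s -> (a <= i)%N) ->
  prob P ([set w | (\sum_(i < a) X i w)%N%:Z = z] `&` fixed s v) =
  jump_law k a z * \prod_(i <- s) prob P [set w | X i w = v i].
Proof.
elim: a z s v => [|a IH] z s v us sa.
  rewrite /jump_law/= /delta0.
  have [->|z0] := eqVneq z 0.
    rewrite (_ : [set _ | _] = setT); last first.
      by apply/seteqP; split=> // w _ /=; rewrite big_ord0.
    rewrite setTI mul1r; apply: EFin_inj; rewrite prob_EFin//.
    case: Xiid => _ Xind _.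
    rewrite /fixed (Xind s (fun i => [set v i]))//.
    rewrite -prodEFin; apply: eq_bigr => i _.
    by rewrite prob_EFin.
  rewrite (_ : [set _ | _] = set0); last first.
    apply/seteqP; split=> // w /=.
    by rewrite big_ord0 => z0'; move: z0; rewrite -z0' eqxx.
  by rewrite set0I mul0r /prob measure0.
have mE := measurableI _ _ (measurable_sum_jumps mX a.+1 z) (mfixed s v).
rewrite (total_probability P mE (mX a)).
have as_ : a \notin s by apply/negP => /sa; rewrite ltnn.
have asE u : prob P ([set w | (\sum_(i < a.+1) X i w)%N%:Z = z] `&` fixed s v
      `&` [set w | X a w = u]) =
    jump_law k a (z - u%:Z) * (prob P [set w | X a w = u] *
      \prod_(i <- s) prob P [set w | X i w = v i]).
  pose v' i := if i == a then u else v i.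
  have v'E i : i \in s -> v' i = v i.
    by move=> si; rewrite /v'; case: eqP => // ia; rewrite -ia si in as_.
  have v'a : v' a = u by rewrite /v' eqxx.
  have fixedE : fixed (a :: s) v' = [set w | X a w = u] `&` fixed s v.
    rewrite /fixed big_cons v'a; congr (_ `&` _).
    by apply: eq_big_seq => i si; rewrite v'E.
  have -> : \prod_(i <- s) prob P [set w | X i w = v i] =
      \prod_(i <- s) prob P [set w | X i w = v' i].
    by apply: eq_big_seq => i si; rewrite v'E.
  have := IH (z - u%:Z) (a :: s) v'; rewrite big_cons v'a fixedE => <-; last 2 first.
  - by rewrite /= as_.
  - by move=> i; rewrite inE => /predU1P[->//|/sa/ltnW].
  congr (prob P _); apply/seteqP; split=> w /=.
    by rewrite big_ord_recr/= PoszD => -[[<- sv] <-]; rewrite addrK.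
  by rewrite big_ord_recr/= PoszD => -[-> [<- sv]]; rewrite subrK.
rewrite (@tsum_finite _ _ k.+1); last first.
  move=> u ku; rewrite asE prob_jump0 ?mul0r ?mulr0//.
  by rewrite negb_and -!ltnNge ku orbT.
rewrite big_ltn// asE prob_jump0// mul0r mulr0 add0r.
rewrite (_ : jump_law k a.+1 z = avg k (- 1) (jump_law k a) z)// /avg mulrAC mulr_sumr.
rewrite big_nat_cond [RHS]big_nat_cond; apply: eq_bigr => u.
by rewrite andbT => /andP[u1 uk]; rewrite asE prob_jump ?u1// mulN1r; ring.
Qed.

Lemma prob_sum_jumps a z :
  prob P [set w | (\sum_(i < a) X i w)%N%:Z = z] = jump_law k a z.
Proof.
have := @prob_sum_fixed a z [::] (fun=> 0%N) isT (fun i (H : i \in [::]) => ltac:(by [])).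
by rewrite /fixed !big_nil setIT mulr1.
Qed.

End uniform_jumps.

(** * The law of the Skellam process of order k *)

Section skellam_process.
Context {d : measure_display} {T : measurableType d} {R : realType}.
Variable P : probability T R.

Lemma generated_sigma_preimage {I : Type} {d' : measure_display}
    {E : measurableType d'} (J : set I) (X : I -> T -> E) i (B : set E) :
  J i -> measurable B -> generated_sigma J X (X i @^-1` B).
Proof. by move=> Ji mB; apply: sub_sigma_algebra; exists i, B. Qed.

Lemma generated_sigma_sum_jumps (X : nat -> T -> nat) a z :
  generated_sigma [set: nat] X [set w | (\sum_(i < a) X i w)%N%:Z = z].
Proof.
pose G := [set A | exists (i : nat) (B : set nat),
  [/\ [set: nat] i, measurable B & A = X i @^-1` B]].
apply: (@measurable_sum_jumps _ (g_sigma_algebraType G) X) => i v.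
exact: (@generated_sigma_preimage _ _ _ _ X i [set v]).
Qed.

Lemma prob_poisson_process rate (N : R -> T -> nat) t n :
  poisson_process P rate N -> 0 < rate -> 0 < t ->
  prob P [set w | N t w = n] = poisson_weight (rate * t) n.
Proof.
move=> [_ N0 _ _ _ Nlaw] rate0 t0.
have := Nlaw 0 t n (lexx _) t0.
rewrite (_ : [set _ | _] = [set w | N t w = n]); last first.
  by apply/seteqP; split=> w /=; rewrite N0 subn0.
rewrite /prob => ->; rewrite subr0 /poisson_pmf mulr_gt0//=.
by rewrite /poisson_weight mulrC.
Qed.

Lemma poisson_process_of_order_law k lambda (Nk : R -> T -> nat) t :
  (0 < k)%N -> 0 < lambda -> poisson_process_of_order P k lambda Nk -> 0 < t ->
  forall z : int, measurable [set w | (Nk t w)%:Z = z] /\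
    prob P [set w | (Nk t w)%:Z = z] =
    tsum (fun a => poisson_weight (k%:R * lambda * t) a * jump_law k a z).
Proof.
move=> k0 lambda0 [N [X [HN HX NX NkE]]] t0 z; have t0' := ltW t0.
have mN v : measurable [set w | N t w = v].
  by case: HN => mN _ _ _ _ _; apply: measurable_preimage_nat; exact: mN.
have mX i v : measurable [set w | X i w = v].
  by case: HX => mX _ _; exact: measurable_preimage_nat.
have NkNE a : [set w | (Nk t w)%:Z = z] `&` [set w | N t w = a] =
    [set w | N t w = a] `&` [set w | (\sum_(i < a) X i w)%N%:Z = z].
  apply/seteqP; split=> w /=; first by move=> [+ <-]; rewrite NkE.
  by move=> [<- <-]; rewrite NkE.
have mNk : measurable [set w | (Nk t w)%:Z = z].
  rewrite (_ : [set _ | _] =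
      \bigcup_a ([set w | N t w = a] `&` [set w | (\sum_(i < a) X i w)%N%:Z = z])).
    apply: bigcupT_measurable => a; apply: measurableI => //.
    exact: measurable_sum_jumps.
  apply/seteqP; split=> w /=; first by move=> Nz; exists (N t w) => //=; rewrite -NkE.
  by move=> [a _ /= [<- <-]]; rewrite NkE.
split=> //; rewrite (total_probability P mNk mN); apply: eq_tsum => a.
rewrite NkNE /prob NX; last 2 first.
- exact: (@generated_sigma_preimage _ _ _ _ N t [set a]).
- exact: generated_sigma_sum_jumps.
rewrite fineM ?fin_num_measure//; last exact: measurable_sum_jumps.
rewrite -!/(prob P _) (prob_sum_jumps k0 HX).
by rewrite (prob_poisson_process _ HN)// mulr_gt0// ltr0n.
Qed.

Variables (k : nat) (lambda1 lambda2 : R) (S : R -> T -> int).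
Hypotheses (k_gt0 : (0 < k)%N) (lambda1_gt0 : 0 < lambda1) (lambda2_gt0 : 0 < lambda2).
Hypothesis S_spok : skellam_process_of_order P k lambda1 lambda2 S.

Let c := k%:R * (lambda1 + lambda2).

Let iter_avgZ b (x : R) f n :
  iter b (avg k 1) (fun n => x * f n) n = x * iter b (avg k 1) f n.
Proof.
suff -> : iter b (avg k 1) (fun n => x * f n) = (fun n => x * iter b (avg k 1) f n) by [].
by elim: b => //= b ->; rewrite avgZ.
Qed.

(** Conditioning on N2 and on both numbers of jumps gives a double Poisson mixture
    of the laws of differences of jump sums. *)
Theorem skellam_process_law t n : 0 < t ->
  measurable [set w | S t w = n] /\
  prob P [set w | S t w = n] =
    tsum (fun j => skellam_law k lambda1 lambda2 j n * poisson_weight (c * t) j).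
Proof.
move=> t0; have t0' := ltW t0.
have [N1 [N2 [HN1 HN2 N12 SE]]] := S_spok.
have law1 := poisson_process_of_order_law k_gt0 lambda1_gt0 HN1 t0.
have law2 := poisson_process_of_order_law k_gt0 lambda2_gt0 HN2 t0.
have y10 : 0 <= k%:R * lambda1 * t by rewrite !mulr_ge0// ltW.
have y20 : 0 <= k%:R * lambda2 * t by rewrite !mulr_ge0// ltW.
have mN2 l : measurable [set w | N2 t w = l].
  rewrite (_ : [set _ | _] = [set w | (N2 t w)%:Z = l%:Z]); first exact: (law2 _).1.
  by apply/seteqP; split=> w /= [->].
have SNE l : [set w | S t w = n] `&` [set w | N2 t w = l] =
    [set w | (N1 t w)%:Z = n + l%:Z] `&` [set w | (N2 t w)%:Z = l%:Z].
  apply/seteqP; split=> w /=; rewrite SE//.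
    by move=> [<- ->]; rewrite subrK.
  by move=> [-> [->]]; rewrite addrK.
have mS : measurable [set w | S t w = n].
  rewrite (_ : [set _ | _] = \bigcup_l ([set w | (N1 t w)%:Z = n + l%:Z] `&`
      [set w | (N2 t w)%:Z = l%:Z])).
    apply: bigcupT_measurable => l; apply: measurableI.
      exact: (law1 _).1.
    exact: (law2 _).1.
  apply/seteqP; split=> w.
    move=> Sn; exists (N2 t w) => //; rewrite -SNE; by split.
  by move=> [l _]; rewrite -SNE => -[].
split=> //; rewrite (total_probability P mS mN2).
pose f z := tsum (fun a => poisson_weight (k%:R * lambda1 * t) a * jump_law k a z).
have jl1 a z : `|jump_law (R := R) k a z| <= 1.
  by have /andP[j0 j1] := jump_law_bounds (R := R) k_gt0 a z; rewrite ger0_norm.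
have l1f z : l1_le 1 (fun a => poisson_weight (k%:R * lambda1 * t) a * jump_law k a z).
  by apply: l1_le_dom (l1_le_poisson_weight y10) => a; rewrite normrM ler_piMr.
have f1 z : `|f z| <= 1 by exact: tsum_norm_le (l1f z).
rewrite -/c -(poisson_mixture k_gt0 lambda1_gt0 lambda2_gt0 n t0').
have l1x b : l1_le (poisson_weight (k%:R * lambda2 * t) b) (fun l : nat =>
    poisson_weight (k%:R * lambda2 * t) b * (f (n + l%:Z) * jump_law k b l)).
  have fj : l1_le 1 (fun l : nat => f (n + l%:Z) * jump_law k b l).
    by apply: l1_le_weight => //; exact: l1_le_jump_law.
  have := l1_leZ (poisson_weight (k%:R * lambda2 * t) b) fj.
  by rewrite mulr1 ger0_norm// poisson_weight_ge0.
transitivity (tsum (fun l : nat => tsum (fun b =>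
    poisson_weight (k%:R * lambda2 * t) b * (f (n + l%:Z) * jump_law k b l)))).
  apply: eq_tsum => l; rewrite SNE /prob N12; last 2 first.
  - exact: (@generated_sigma_preimage _ _ _ _ N1 t [set v | v%:Z = n + l%:Z]).
  - exact: (@generated_sigma_preimage _ _ _ _ N2 t [set v | v%:Z = l%:Z]).
  rewrite fineM ?fin_num_measure//; [|exact: (law1 _).1|exact: (law2 _).1].
  rewrite -!/(prob P _) (law1 _).2 (law2 _).2 -/(f _).
  have l1b : l1_le 1 (fun b => poisson_weight (k%:R * lambda2 * t) b * jump_law k b l).
    by apply: l1_le_dom (l1_le_poisson_weight y20) => b; rewrite normrM ler_piMr.
  by rewrite -(tsumZ _ l1b); apply: eq_tsum => b; rewrite mulrCA.
rewrite (tsum_exchange l1x (l1_le_poisson_weight y20)); apply: eq_tsum => b.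
have fj : l1_le 1 (fun l : nat => f (n + l%:Z) * jump_law k b l).
  by apply: l1_le_weight => //; exact: l1_le_jump_law.
rewrite (tsumZ _ fj) tsum_jump_law//; congr (_ * _).
rewrite /f (iter_avg_tsum k_gt0 b l1f).2; apply: eq_tsum => a.
exact: iter_avgZ.
Qed.

Let natr_dist_lt1 (m n : nat) : `|m%:R - n%:R| < 1 :> R -> m = n.
Proof.
rewrite ltr_distl ltrBlDr !natr1 !ltr_nat !ltnS => nmn.
by apply/eqP; rewrite eqn_leq andbC.
Qed.

(** A right-continuous counting path is constant on a right neighbourhood of each
    point, and the jump sums depend on time only through the counting paths. *)
Lemma skellam_path_right_constant w x : 0 <= x ->
  \forall y \near x^'+, S y w = S x w.
Proof.
have [N1 [N2 [HN1 HN2 N12 SE]]] := S_spok.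
have nat_const lambda (Nk : R -> T -> nat) : poisson_process_of_order P k lambda Nk ->
    0 <= x -> \forall y \near x^'+, Nk y w = Nk x w.
  move=> [N [X [[_ _ _ Nrc _ _] _ _ NkE]]] x0.
  have /cvgrPdist_lt/(_ 1 ltr01) := Nrc w x x0.
  move=> NN; near=> y.
  have xy : x < y by near: y; exact: nbhs_right_gt.
  have : `|(N x w)%:R - (N y w)%:R| < 1 :> R by near: y.
  rewrite !NkE ?(le_trans x0 (ltW xy))//.
  by move=> /natr_dist_lt1 ->.
move=> x0.
have c1 := nat_const _ _ HN1 x0; have c2 := nat_const _ _ HN2 x0.
near=> y.
have xy : x < y by near: y; exact: nbhs_right_gt.
rewrite !SE ?(le_trans x0 (ltW xy))//; congr (Posz _ - Posz _); by near: y.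
Unshelve. all: by end_near. Qed.

End skellam_process.

(** * Evaluation at an independent random time *)

Section poisson_average_continuity.
Context {R : realType}.
Implicit Types (x y : R) (kap : nat -> R).

Lemma l1_le_poisson_weight_real y :
  l1_le (expR (- y) * expR `|y|) (poisson_weight y).
Proof.
have := l1_leZ (expR (- y)) (l1_le_exp_coeff (lexx `|y|)).
by rewrite (ger0_norm (expR_ge0 _)).
Qed.

(** The weights form a semigroup with Phi(z) = 1 - z, so their averages are
    differentiable by [is_derive_pairing]; shifting time by 1 makes y = 0 an
    interior point. *)
Lemma continuous_poisson_average kap x : (forall j, `|kap j| <= 1) -> 0 <= x ->
  {for x, continuous (fun y => tsum (fun j => kap j * poisson_weight y j))}.
Proof.
move=> kap1 x0.
(* the coefficients of 1 - z *)
pose b j : R := delay (fun i => - (i == 0%N)%:R) j + (j == 0%N)%:R.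
pose e0 (j : nat) : R := (j == 0%N)%:R.
have l1e0 : l1_le 1 e0.
  move=> [|N]; first by rewrite big_nil.
  rewrite big_nat_recl//= big1 ?addr0 ?normr1//.
  by move=> i _; rewrite normr0.
have gfe0 z : gf z e0 = 1.
  rewrite /gf (@tsum_finite _ _ 1); first by rewrite big_nat1 expr0 mul1r.
  by move=> [|j]//= _; rewrite mulr0.
have l1b : l1_le (1 + 1) b by apply: l1_leD => //; apply: l1_le_delay; exact: l1_leN.
have gfb z : 0 < z < 1 -> gf z b = 1 - z.
  move=> z01; rewrite /gf /b; under eq_tsum do rewrite mulrDr.
  have l1d := l1_le_delay (l1_leN l1e0).
  rewrite (tsumD (l1_le_gf z01 l1d) (l1_le_gf z01 l1e0)) -!/(gf _ _) gfe0.
  rewrite (gf_delay z01 (l1_leN l1e0)) /gf.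
  under eq_tsum do rewrite mulrN.
  by rewrite (tsumN (l1_le_gf z01 l1e0)) -/(gf _ _) gfe0 mulrN1 addrC.
have x1 : 0 < x + 1 by rewrite ltr_wpDl.
have wC (s z : R) : 0 < s -> 0 < z < 1 ->
    gf z (poisson_weight (s - 1)) = expR (1 - z) * expR (- (s * (1 - z))).
  by move=> _ _; rewrite gf_poisson_weight -expRD; congr expR; ring.
have [dw _] := is_derive_pairing (w := fun s => poisson_weight (s - 1))
  (C := fun z => expR (1 - z)) l1b gfb
  (fun s _ => l1_le_poisson_weight_real (s - 1)) wC kap1 x1.
move: dw => /derivable1_diffP/differentiable_continuous cw.
have -> : (fun y => tsum (fun j => kap j * poisson_weight y j)) =
    (fun s => tsum (fun j => kap j * poisson_weight (s - 1) j)) \o (fun y => y + 1).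
  by apply/funext => y /=; rewrite addrK.
apply: continuous_comp; last exact: cw.
by apply: cvgD; [exact: cvg_id|exact: cvg_cst].
Qed.

End poisson_average_continuity.

Section bounded_convergence.
Context {d : measure_display} {T : measurableType d} {R : realType}.
Variable P : probability T R.

Lemma bounded_convergence (f : nat -> T -> R) (g : T -> R) :
  (forall m, measurable_fun setT (f m)) ->
  (forall m w, `|f m w| <= 1) ->
  (forall w, f m w @[m --> \oo] --> g w) ->
  measurable_fun setT g /\
  (\int[P]_w (f m w)%:E @[m --> \oo] --> \int[P]_w (g w)%:E)%E.
Proof.
move=> mf f1 fg.
have mg : measurable_fun setT g by exact: (measurable_fun_cvg mf (fun w _ => fg w)).
split=> //.
have [|||||_ _] // := @dominated_convergence _ _ _ P setT measurableT
  (fun m w => (f m w)%:E) (EFin \o g) (cst 1%E).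
- by move=> m; exact/measurable_EFinP.
- exact/measurable_EFinP.
- by apply: aeW => w _; apply: cvg_EFin; [exact: nearW|exact: fg].
- by apply: finite_measure_integrable_cst.
- by apply: aeW => w m _; rewrite /= lee_fin.
Qed.

End bounded_convergence.
Section random_time.
Context {d : measure_display} {T : measurableType d} {R : realType}.
Variables (P : probability T R) (k : nat) (lambda1 lambda2 : R).
Variables (D : R -> T -> R) (S : R -> T -> int).
Hypotheses (k_gt0 : (0 < k)%N) (lambda1_gt0 : 0 < lambda1) (lambda2_gt0 : 0 < lambda2).
Hypothesis S_spok : skellam_process_of_order P k lambda1 lambda2 S.
Hypothesis D_S_indep : independent_processes P D S.
Variables (t : R) (n : int).
Hypothesis t_ge0 : 0 <= t.
Hypothesis mD : measurable_fun setT (D t).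
Hypothesis D_ge0 : forall w, 0 <= D t w.

Let c := k%:R * (lambda1 + lambda2).
Let kap j : R := skellam_law k lambda1 lambda2 j n.
Let F (y : R) : R := tsum (fun j => kap j * poisson_weight (c * y) j).

Let c_ge0 : 0 <= c. Proof. by apply: mulr_ge0 => //; apply: addr_ge0; exact: ltW. Qed.

Let kap01 j : 0 <= kap j <= 1. Proof. exact: skellam_law_bounds. Qed.

Let kap1 j : `|kap j| <= 1.
Proof. by case/andP: (kap01 j) => ? ?; rewrite ger0_norm. Qed.

Let F01 (y : R) : 0 <= y -> 0 <= F y <= 1.
Proof.
move=> y0; have cy0 : 0 <= c * y by rewrite mulr_ge0.
apply/andP; split.
  apply: tsum_ge0 => j; rewrite mulr_ge0 ?poisson_weight_ge0//.
  by case/andP: (kap01 j).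
apply: le_trans (ler_norm _) _; apply: tsum_norm_le.
exact: l1_le_weight (l1_le_poisson_weight cy0).
Qed.

Let cvg_F (u : nat -> R) (y : R) : 0 <= y -> u @ \oo --> y ->
  F (u m) @[m --> \oo] --> F y.
Proof.
move=> y0 uy.
have cont := continuous_poisson_average kap1 (mulr_ge0 c_ge0 y0).
have cuy : c * u m @[m --> \oo] --> c * y by apply: cvgM => //; exact: cvg_cst.
exact: (cvg_comp _ _ cuy cont).
Qed.

(* D t is approximated strictly from above on the grid of mesh 1/(m+1): there it
   has countably many values, and S is right-continuous. *)
Let Y m w : nat := Num.truncn (m.+1%:R * D t w).
Let grid m i : R := i.+1%:R / m.+1%:R.
Let Dm m w : R := grid m (Y m w).

Let grid_gt0 m i : 0 < grid m i.
Proof. by rewrite divr_gt0. Qed.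

Let Dm_gt m w : D t w < Dm m w.
Proof. by rewrite /Dm /grid ltr_pdivlMr// mulrC truncnS_gt. Qed.

Let Dm_le m w : Dm m w <= D t w + m.+1%:R^-1.
Proof.
rewrite /Dm /grid -natr1 mulrDl mul1r lerD2r ler_pdivrMr// [leRHS]mulrC.
by rewrite truncn_le mulr_ge0.
Qed.

Let cvg_Dm w : Dm m w @[m --> \oo] --> D t w.
Proof.
apply: (@squeeze_cvgr _ _ _ _ (fun=> D t w) (fun m => D t w + m.+1%:R^-1)).
- by apply: nearW => m /=; rewrite Dm_le andbT ltW ?Dm_gt.
- exact: cvg_cst.
- rewrite -[X in _ --> X]addr0; apply: cvgD; first exact: cvg_cst.
  exact: cvg_harmonic.
Qed.

Let cell m i : set R := `[i%:R / m.+1%:R, i.+1%:R / m.+1%:R[.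

Let YE m i : [set w | Y m w = i] = D t @^-1` cell m i.
Proof.
have m0 : 0 < m.+1%:R :> R by [].
have mDw w : 0 <= m.+1%:R * D t w by rewrite mulr_ge0.
apply/seteqP; split=> w /=; rewrite /cell/= in_itv/= ler_pdivrMr// ltr_pdivlMr//.
  by move=> <-; rewrite mulrC truncn_itv.
by rewrite mulrC -truncn_eq// => /eqP.
Qed.

Let mY m i : measurable [set w | Y m w = i].
Proof.
rewrite YE -[X in measurable X]setTI.
exact: (mD measurableT (measurable_itv _)).
Qed.

Let E m : set T := [set w | S (Dm m w) w = n].
Let E0 : set T := [set w | S (D t w) w = n].

Let E_cell m i : E m `&` [set w | Y m w = i] =
  [set w | Y m w = i] `&` [set w | S (grid m i) w = n].
Proof.
by apply/seteqP; split=> w /=; rewrite /E/= /Dm; [move=> [+ <-]|move=> [<-]].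
Qed.

Let law i m := skellam_process_law k_gt0 lambda1_gt0 lambda2_gt0 S_spok n (grid_gt0 m i).

Let mE m : measurable (E m).
Proof.
rewrite (_ : E m = \bigcup_i ([set w | Y m w = i] `&` [set w | S (grid m i) w = n])).
  apply: bigcupT_measurable => i; apply: measurableI => //; exact: (law i m).1.
apply/seteqP; split=> w; first by move=> Ew; exists (Y m w) => //; rewrite -E_cell.
by move=> [i _]; rewrite -E_cell => -[].
Qed.

Let prob_E_cell m i : prob P (E m `&` [set w | Y m w = i]) =
  F (grid m i) * prob P [set w | Y m w = i].
Proof.
rewrite E_cell YE /prob D_S_indep; last 2 first.
- exact: generated_sigma_preimage (measurable_itv _).
- apply: (generated_sigma_preimage (X := S) (i := grid m i) (B := [set n])) => //=.
  exact: ltW.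
rewrite -YE fineM ?fin_num_measure//; last exact: (law i m).1.
by rewrite -!/(prob P _) (law i m).2 mulrC.
Qed.

Let prob_E m : (prob P (E m))%:E = (\int[P]_w (F (Dm m w))%:E)%E.
Proof.
rewrite (total_probability P (mE m) (mY m)).
under eq_tsum do rewrite prob_E_cell.
have mf i : measurable_fun setT (\1_[set w | Y m w = i] : T -> R).
  exact: measurable_indic.
have sumE w (g : nat -> R) :
    tsum (fun i => g i * \1_[set w | Y m w = i] w) = g (Y m w).
  rewrite (@tsum_finite _ _ (Y m w).+1); last first.
    move=> i wi; rewrite indicE memNset ?mulr0//= => Yi.
    by rewrite Yi ltnn in wi.
  rewrite big_nat_recr//= indicE mem_set// mulr1 big_nat_cond big1 ?add0r// => i.
  rewrite andbT => /andP[_ iY]; rewrite indicE memNset ?mulr0//= => Yi.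
  by rewrite Yi ltnn in iY.
have f0 i w : setT w -> 0 <= \1_[set w | Y m w = i] w :> R by rewrite indicE.
have f1 w : setT w -> l1_le (cst 1 w) (fun i => \1_[set w | Y m w = i] w : R).
  move=> _ N; under eq_bigr do rewrite ger0_norm ?f0//.
  suff -> : \sum_(0 <= i < N) \1_[set w | Y m w = i] w = (Y m w < N)%N%:R :> R.
    by rewrite lern1 leq_b1.
  elim: N => [|N IH]; first by rewrite big_nil.
  rewrite big_nat_recr//= IH indicE [in RHS]ltnS [in RHS]leq_eqVlt.
  have [YN|YN] := eqVneq (Y m w) N.
    rewrite mem_set// YN.
    by rewrite ltnn add0r.
  by rewrite memNset ?addr0//= => YN'; rewrite YN' eqxx in YN.
have G1 : (\int[P]_(w in setT) (cst 1 w)%:E <= 1%:E)%E.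
  by rewrite (eq_integral (cst 1%E))// integral_cst//= probability_setT mule1.
have F01' i : 0 <= F (grid m i) <= 1 by apply: F01; exact: ltW.
transitivity (\int[P]_w (tsum (fun i =>
    F (grid m i) * \1_[set w | Y m w = i] w))%:E)%E; last first.
  by apply: eq_integral => w _; rewrite sumE.
rewrite -(tonelli_tsum (m := P) measurableT mf (measurable_cst _) f0 f1 G1 F01').
congr EFin; apply: eq_tsum => i; congr (_ * _).
by rewrite /Rintegral integral_indic// setIT.
Qed.

Let measurable_F_Dm m : measurable_fun setT (fun w => F (Dm m w)).
Proof.
have mYfun : measurable_fun setT (Y m).
  move=> _ B _; rewrite setTI.
  rewrite (_ : _ @^-1` B = \bigcup_(i in B) [set w | Y m w = i]).
    by apply: bigcup_measurable => i _; exact: mY.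
  by apply/seteqP; split=> w /=; [move=> BY; exists (Y m w)|move=> [i Bi ->]].
by apply: (@measurableT_comp _ _ _ _ _ _ (fun i => F (grid m i)) _ (Y m)).
Qed.

Let cvg_indic w : (\1_(E m) w : R) @[m --> \oo] --> (\1_E0 w : R).
Proof.
have [e /= e0 He] := skellam_path_right_constant S_spok w (D_ge0 w).
apply: cvg_near_cst.
have /cvgrPdist_lt/(_ _ e0) := @cvg_Dm w.
apply: filterS => m Dme; have := He (Dm m w) Dme (Dm_gt m w).
by move=> SE; rewrite !indicE /E /E0; congr (_%:R); congr nat_of_bool;
  apply/idP/idP; rewrite !inE/= SE.
Qed.

(** The formula holds for the approximations of D t by summing over their values,
    and passes to the limit by bounded convergence on both sides. *)
Theorem prob_random_time :
  (prob P [set w | S (D t w) w = n])%:E =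
  (\int[P]_w (tsum (fun j => skellam_law k lambda1 lambda2 j n *
    poisson_weight (k%:R * (lambda1 + lambda2) * D t w) j))%:E)%E.
Proof.
have [mE0 limE] : measurable_fun setT (\1_E0 : T -> R) /\
    (\int[P]_w (\1_(E m) w)%:E @[m --> \oo] --> \int[P]_w (\1_E0 w)%:E)%E.
  apply: bounded_convergence.
  - by move=> m; apply: measurable_indic; exact: mE.
  - by move=> m w; rewrite indicE; case: (_ \in _); rewrite ?normr1 ?normr0.
  - exact: cvg_indic.
have [_ limF] : measurable_fun setT (fun w => F (D t w)) /\
    (\int[P]_w (F (Dm m w))%:E @[m --> \oo] --> \int[P]_w (F (D t w))%:E)%E.
  apply: bounded_convergence.
  - exact: measurable_F_Dm.
  - move=> m w; have Dm0 : 0 <= Dm m w by exact: ltW (grid_gt0 _ _).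
    by have /andP[F0 F1] := F01 Dm0; rewrite ger0_norm.
  - by move=> w; apply: cvg_F => //; exact: cvg_Dm.
have {}mE0 : measurable E0.
  have := mE0 measurableT _ (measurable_itv `]0, +oo[); rewrite setTI.
  congr (measurable _); apply/seteqP; split=> w /=.
    rewrite indicE in_itv/= andbT; case: (boolP (w \in E0)); rewrite ?inE// => _.
    by rewrite ltxx.
  by move=> Ew; rewrite indicE mem_set// in_itv/= ltr01.
have limF' := cvg_lim (@ereal_hausdorff R) limF.
have limE' := cvg_lim (@ereal_hausdorff R) limE.
rewrite -[RHS]limF' prob_EFin// -[X in P X]setIT -integral_indic//.
rewrite -limE'; congr (limn _); apply/funext => m.
by rewrite -prob_E integral_indic// setIT prob_EFin.
Qed.

End random_time.

(** * The governing equation *)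

Section time_changed_skellam.
Context {R : realType} {d : measure_display} {T : measurableType d}.
Variables (P : probability T R) (k : nat) (lambda1 lambda2 nu eta : R).
Variables (D : R -> T -> R) (S : R -> T -> int).
Hypotheses (k_gt0 : (0 < k)%N) (lambda1_gt0 : 0 < lambda1) (lambda2_gt0 : 0 < lambda2).
Hypothesis D_tss : tempered_stable_subordinator P eta nu D.
Hypothesis S_spok : skellam_process_of_order P k lambda1 lambda2 S.
Hypothesis D_S_indep : independent_processes P D S.

Let c := k%:R * (lambda1 + lambda2).
Let h := subordinated_weight P eta nu c D.
Let p := time_changed_pmf P S D.

Let c_gt0 : 0 < c.
Proof. by rewrite mulr_gt0 ?ltr0n// addr_gt0. Qed.

Let kap01 n j : 0 <= skellam_law k lambda1 lambda2 j n <= 1.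
Proof. exact: skellam_law_bounds. Qed.

Let kap1 n j : `|skellam_law k lambda1 lambda2 j n| <= 1.
Proof. by case/andP: (kap01 n j) => ? ?; rewrite ger0_norm. Qed.

Lemma time_changed_pmfE n t : 0 < t ->
  p n t = expR (eta `^ nu * t) *
    tsum (fun j => skellam_law k lambda1 lambda2 j n * h t j).
Proof.
move=> t0; have t0' := ltW t0.
have mD : measurable_fun setT (D t) by case: D_tss => -[mD _ _ _ _ _] _; exact: mD.
have := tsum_subordinated c_gt0 D_tss t0' (kap01 n).
rewrite -(prob_random_time k_gt0 lambda1_gt0 lambda2_gt0 S_spok D_S_indep n t0' mD
  (fun w => tss_ge0 D_tss w t0')) -EFinM => -[] ->.
by rewrite mulrA -expRD addrN expR0 mul1r.
Qed.

(** Delaying the weights by one index replaces the law of j jumps by that of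
    j + 1 jumps, which is one more averaging over the states n - i and n + i. *)
Lemma jump_time_changed_pmf n t : 0 < t ->
  c * (expR (eta `^ nu * t) *
    tsum (fun j => skellam_law k lambda1 lambda2 j n * delay (h t) j)) =
  lambda1 * (\sum_(1 <= j < k.+1) p (n - j%:Z) t) +
  lambda2 * (\sum_(1 <= j < k.+1) p (n + j%:Z) t).
Proof.
move=> t0; have hl1 := l1_le_subordinated c_gt0 D_tss (ltW t0).
rewrite -/h in hl1.
have l1k n' := l1_le_weight (kap1 n') hl1.
have sum_p (s : int) : \sum_(1 <= j < k.+1) p (n + s * j%:Z) t =
    expR (eta `^ nu * t) * tsum (fun j => \sum_(0 <= v < k)
      skellam_law k lambda1 lambda2 j (n + s * v.+1%:Z) * h t j).
  rewrite big_add1/= (tsum_sum k (fun v => l1k (n + s * v.+1%:Z))) mulr_sumr.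
  by apply: eq_bigr => v _; rewrite time_changed_pmfE.
have := sum_p (- 1); have := sum_p 1.
under eq_bigr do rewrite mul1r.
move=> ->; under eq_bigr do rewrite mulN1r.
move=> ->.
rewrite (tsum_recl (l1_le_weight (kap1 n) (l1_le_delay hl1)))/= mulr0 add0r.
set e := expR _.
pose A s j := \sum_(0 <= v < k)
  skellam_law k lambda1 lambda2 j (n + s * v.+1%:Z) * h t j.
have l1A s := l1_le_sum k (fun v => l1k (n + s * v.+1%:Z)).
have l1S : l1_le (expR (- (eta `^ nu * t)))
    (fun j => skellam_law k lambda1 lambda2 j.+1 n * h t j).
  by apply: l1_le_weight => // j; exact: kap1.
rewrite -!/(A _ _) [LHS]mulrCA [X in _ = X + _]mulrCA [X in _ = _ + X]mulrCA -mulrDr.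
congr (_ * _); rewrite -(tsumZ _ l1S) -(tsumZ _ (l1A (- 1))) -(tsumZ _ (l1A 1)).
rewrite -(tsumD (l1_leZ _ (l1A (- 1))) (l1_leZ _ (l1A 1))).
apply: eq_tsum => j; rewrite mulrA /skellam_law iterS -/(skellam_law _ _ _ j).
rewrite (skellam_stepE k_gt0 lambda1_gt0 lambda2_gt0) mulrDl -!mulrA !mulr_suml.
rewrite !big_add1/=; congr (_ * _ + _ * _); apply: eq_bigr => v _.
  by rewrite mulN1r.
by rewrite mul1r.
Qed.

End time_changed_skellam.

Theorem proposition3p1 (R : realType) (d : measure_display)
    (T : measurableType d) (P : probability T R)
    (k : nat) (lambda1 lambda2 nu eta : R)
    (D : R -> T -> R) (S : R -> T -> int)
    (k_ge1 : (1 <= k)%N) (lambda1_gt0 : 0 < lambda1) (lambda2_gt0 : 0 < lambda2)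
    (nu_gt0 : 0 < nu) (nu_lt1 : nu < 1) (eta_gt0 : 0 < eta)
    (D_tss : tempered_stable_subordinator P eta nu D)
    (S_spok : skellam_process_of_order P k lambda1 lambda2 S)
    (D_S_indep : independent_processes P D S) :
  let p := time_changed_pmf P S D in
  forall n : int,
    frac_shifted_derivable (eta `^ nu) (1 / nu) (p n) /\
    forall t : R, 0 < t ->
      frac_shifted_derive (eta `^ nu) (1 / nu) (p n) t =
        eta * p n t + k%:R * (lambda1 + lambda2) * p n t
        - lambda1 * (\sum_(1 <= j < k.+1) p (n - j%:Z) t)
        - lambda2 * (\sum_(1 <= j < k.+1) p (n + j%:Z) t).
Proof.
move=> p n; rewrite {}/p.
have c_gt0 : 0 < k%:R * (lambda1 + lambda2) by rewrite mulr_gt0 ?ltr0n// addr_gt0.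
have nu01 : 0 < nu < 1 by rewrite nu_gt0.
pose kap j := skellam_law k lambda1 lambda2 j n.
have kap01 j : 0 <= kap j <= 1 by exact: skellam_law_bounds.
have kap1 j : `|kap j| <= 1 by case/andP: (kap01 j) => ? ?; rewrite ger0_norm.
set c := k%:R * (lambda1 + lambda2).
have hl1 t (t0 : 0 < t) := l1_le_subordinated c_gt0 D_tss (ltW t0).
have pE t (t0 : 0 < t) := time_changed_pmfE k_ge1 lambda1_gt0 lambda2_gt0
  D_tss S_spok D_S_indep n t0.
have [derivable_p deriveE] := frac_shifted_derive_tempered eta_gt0 c_gt0 nu01
  (h := subordinated_weight P eta nu c D)
  (fun t j t0 => subordinated_weight_ge0 c_gt0 D_tss (ltW t0) j) hl1
  (fun t z t0 z01 => gf_subordinated c_gt0 D_tss t0 z01) kap01 pE.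
split=> // t t0; rewrite deriveE// -addrA -opprD.
rewrite -(jump_time_changed_pmf k_ge1 lambda1_gt0 lambda2_gt0
  D_tss S_spok D_S_indep n t0).
rewrite -mulrDl pE// -/c.
have l1h := l1_le_weight kap1 (hl1 t t0).
have l1d := l1_le_weight kap1 (l1_le_delay (hl1 t t0)).
under eq_tsum do rewrite mulrDr mulrN [X in X - _]mulrCA [X in _ - X]mulrCA.
rewrite (tsumD (l1_leZ _ l1h) (l1_leN (l1_leZ _ l1d))) (tsumN (l1_leZ _ l1d)).
rewrite (tsumZ _ l1h) (tsumZ _ l1d).
by rewrite /kap; ring.
Qed.
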